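(* Consider the single-parameter exponential family $f_\theta(y)=c(\theta)h(y)e^{\theta T(y)}$ described in the context. Suppose that $g$ is continuously differentiable on $(0,1)$, continuous at $0$ and $1$, and $g'(t)>0$ for $0<t<1$, and that $\Theta_0=[a,b]$ and $\Theta=[-K,K]$ for some $K>\max\{|a|,|b|\}$, with $\Theta_1=\Theta\setminus\Theta_0$. Then there exists an optimal rule $\delta^*$ for the problem $$\max_{\delta\in\Delta}\int_{\Theta_1}g(p(\theta;\delta))\,\Lambda_1(d\theta)\quad\text{subject to } \int_{\Theta_0}p(\theta;\delta)\,\Lambda_0(d\theta)\le\alpha$$ such that $\int_a^b p(\theta;\delta^* )\,\Lambda_0(d\theta)=\alpha$ and, for some constants $-\infty\le\ell<u\le\infty$ and a measurable function $\gamma:\mathbb{Y}\to[0,1]$, for each $y\in\mathbb{Y}$, $$\delta^*(y)=\begin{cases}1,&T(y)>u\text{ or }T(y)<\ell\\ \gamma(y),&T(y)\in\{\ell,u\}\\ 0,&\ell<T(y)<u.\end{cases}$$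
   Context: Let $\mathbb{Y}\subset\mathbb{R}^{d_2}$ ($d_2\ge1$) and let $\mu$ be a $\sigma$-finite measure on $\mathbb{Y}$. Let $h:\mathbb{Y}\to[0,\infty)$ and $T:\mathbb{Y}\to\mathbb{R}$ be given measurable functions, and let $\mathcal{D}:=\{\theta\in\mathbb{R}: c(\theta)^{-1}:=\int_{\mathbb{Y}}h(y)e^{\theta T(y)}\,\mu(dy)<\infty\}$. Assume that $\mathcal{D}$ is open and that the compact parameter space $\Theta$ satisfies $\Theta\subset\mathcal{D}$. For $\theta\in\Theta$, $f_\theta(y)=c(\theta)h(y)e^{\theta T(y)}$ is a probability density with respect to $\mu$. $\Delta$ is the set of all randomized decision rules, i.e. measurable functions $\delta:\mathbb{Y}\to[0,1]$, and $p(\theta;\delta)=\int_{\mathbb{Y}}\delta(y)f_\theta(y)\,\mu(dy)$. Here $\alpha\in(0,1)$, $g:[0,1]\to\mathbb{R}$ is a measurable function, and $\Lambda_0,\Lambda_1$ are probability measures on $\Theta_0$ and $\Theta_1$ respectively.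
   Formalization: The strict inequality ℓ<u fails in general (e.g. μ=0.9δ_0+0.1N(0,1), T(y)=y, Λ_0=δ_0, Λ_1 uniform on {-1,1}, α=1/2); the theorem proves ℓ≤u, with ℓ=u only when {T=ℓ} has positive mass under h dμ. *)

(* Defs.v *)
From HB Require Import structures.
From mathcomp Require Import all_boot all_order all_algebra.
From mathcomp Require Import all_classical all_reals all_analysis.

Set Implicit Arguments.
Unset Strict Implicit.
Unset Printing Implicit Defensive.
Import Order.TTheory GRing.Theory Num.Theory numFieldNormedType.Exports.
Local Open Scope classical_set_scope.
Local Open Scope ring_scope.

(* An arbitrary nonempty subset [Y] of R^n as a type. Measurable types of the
   library are pointed, so a witness [y0] of nonemptiness is carried along; it
   plays no other role. *)
Definition subset_type (R : realType) (n : nat) (Y : set (n.-tuple R))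
  (y0 : Y) : Type := Y.
HB.instance Definition _ (R : realType) (n : nat) (Y : set (n.-tuple R))
  (y0 : Y) := Choice.on (subset_type y0).
HB.instance Definition _ (R : realType) (n : nat) (Y : set (n.-tuple R))
  (y0 : Y) := isPointed.Build (subset_type y0) y0.

Definition ambient (R : realType) (n : nat) (Y : set (n.-tuple R)) (y0 : Y)
  (y : subset_type y0) : n.-tuple R := \val (y : Y).

(* [Y] with the trace of the Borel sigma-algebra of R^n (which is the product
   sigma-algebra carried by [n.-tuple R]). [Y] itself need not be Borel. *)
Definition sample_space (R : realType) (n : nat) (Y : set (n.-tuple R))
    (y0 : Y) :=
  g_sigma_algebra_preimageType (@ambient R n Y y0).

(* c(theta)^{-1}, possibly +oo. *)
Definition normalizer d (Y : measurableType d) (R : realType)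
    (mu : {measure set Y -> \bar R}) (h T : Y -> R) (theta : R) : \bar R :=
  (\int[mu]_y (h y * expR (theta * T y))%:E)%E.

Definition natural_space d (Y : measurableType d) (R : realType)
    (mu : {measure set Y -> \bar R}) (h T : Y -> R) : set R :=
  [set theta | (normalizer mu h T theta < +oo)%E].

Definition expfam_density d (Y : measurableType d) (R : realType)
    (mu : {measure set Y -> \bar R}) (h T : Y -> R) (theta : R) (y : Y) : R :=
  (fine (normalizer mu h T theta))^-1 * h y * expR (theta * T y).

Definition decision_rule d (Y : measurableType d) (R : realType) :
    set (Y -> R) :=
  [set delta : Y -> R | measurable_fun [set: Y] delta
                      /\ forall y, 0 <= delta y <= 1].

Definition rejection_prob d (Y : measurableType d) (R : realType)
    (mu : {measure set Y -> \bar R}) (f : R -> Y -> R) (theta : R)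
    (delta : Y -> R) : R :=
  \int[mu]_y (delta y * f theta y).

Definition average_size d (Y : measurableType d) (R : realType)
    (mu : {measure set Y -> \bar R}) (f : R -> Y -> R) (Theta0 : set R)
    (Lambda0 : probability R R) (delta : Y -> R) : R :=
  \int[Lambda0]_(theta in Theta0) rejection_prob mu f theta delta.

Definition objective d (Y : measurableType d) (R : realType)
    (mu : {measure set Y -> \bar R}) (f : R -> Y -> R) (g : R -> R)
    (Theta1 : set R) (Lambda1 : probability R R) (delta : Y -> R) : R :=
  \int[Lambda1]_(theta in Theta1) g (rejection_prob mu f theta delta).

Definition feasible_rule d (Y : measurableType d) (R : realType)
    (mu : {measure set Y -> \bar R}) (f : R -> Y -> R) (Theta0 : set R)
    (Lambda0 : probability R R) (alpha : R) : set (Y -> R) :=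
  [set delta : Y -> R | decision_rule delta
                      /\ average_size mu f Theta0 Lambda0 delta <= alpha].

Definition optimal_rule d (Y : measurableType d) (R : realType)
    (mu : {measure set Y -> \bar R}) (f : R -> Y -> R) (g : R -> R)
    (Theta0 Theta1 : set R) (Lambda0 Lambda1 : probability R R) (alpha : R)
    (delta : Y -> R) : Prop :=
  feasible_rule mu f Theta0 Lambda0 alpha delta /\
  forall delta', feasible_rule mu f Theta0 Lambda0 alpha delta' ->
    objective mu f g Theta1 Lambda1 delta'
      <= objective mu f g Theta1 Lambda1 delta.

(* The rule rejects outside [l, u], accepts inside ]l, u[ and randomizes on the
   boundary. The degenerate case l = u (reject off {T = l}, randomize on it) is
   meaningful: it is the form of the essentially unique optimal rule when the
   law of T has a large atom at l and is diffuse elsewhere, e.g. for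
   0.9 dirac_0 + 0.1 N(0,1), T = id, Lambda0 = dirac_0, Lambda1 uniform on
   {-1, 1}, g = id and alpha = 1/2. *)
Definition two_sided d (Y : measurableType d) (R : realType) (T : Y -> R)
    (l u : \bar R) (gamma delta : Y -> R) : Prop :=
  forall y,
    [/\ ((u < (T y)%:E)%E \/ ((T y)%:E < l)%E) -> delta y = 1,
        ((T y)%:E = l \/ (T y)%:E = u) -> delta y = gamma y
      & (l < (T y)%:E < u)%E -> delta y = 0].

(* Main.v *)
Require Import Defs.
From HB Require Import structures.
From mathcomp Require Import all_boot all_order all_algebra.
From mathcomp Require Import all_classical all_reals all_analysis.
From mathcomp Require Import measurable_realfun.
From mathcomp Require Import ring lra.

Set Implicit Arguments.
Unset Strict Implicit.
Unset Printing Implicit Defensive.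
Import Order.TTheory GRing.Theory Num.Theory numFieldNormedType.Exports.
Local Open Scope classical_set_scope.
Local Open Scope ring_scope.

(** The optimal rule is found inside a family with two real parameters, so that
    no compactness of the set of all rules is needed.

    Take the law P with density f_a as reference. The density f_theta is a
    positive multiple of exp((theta - a) T) f_a, so the power of a rule at theta
    is, up to a positive factor, its P-integral against exp((theta - a) T). Let
    x = exp((b - a) T) if a < b and x = T if a = b. As a function of x,
    exp((theta - a) T) is convex for theta outside [a, b] and concave for theta
    inside (expR_convex_in_expR, expR_concave_in_expR). Let a rule delta' reject
    outside [l, u] and accept inside, and have the same P-integrals against 1
    and x as a given rule delta. Then w = delta' - delta is nonnegative outside
    [l, u], nonpositive inside and orthogonal to all affine functions of x.
    Subtracting from a convex function of x its chord between l and u shows that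
    its integral against w is nonnegative (two_sign_changes). Hence delta' has at
    least the power of delta on Theta_1, and at most that on Theta_0.

    Such a delta' exists in the family outer_test s v, 0 <= s <= v <= 1, which
    accepts between the quantiles of orders s and v of the law of T under P,
    randomized on the two cutoffs so that the P-mass of acceptance is exactly
    v - s. This choice of parameters makes the power at every theta, and the
    P-integral of x times the test, continuous in (s, v), atoms or not
    (continuous_outer_test). Fixing v - s matches the first integral, and the intermediate value theorem along s
    matches the second, since by the Neyman-Pearson argument one-sided tests are
    extremal for it (outer_test_matching).

    A feasible rule is therefore dominated by some outer_test s v of size at most
    alpha, and increasing s raises the size to alpha without lowering the
    objective, as g is increasing (exists_better_outer_test). It remains to
    maximize a continuous function of (s, v) over the compact set of pairs with
    size alpha (exists_optimal_outer_test). *)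

(** * Integrals of real functions *)

Section real_integration.
Context d (Y : measurableType d) (R : realType).
Variable mu : {measure set Y -> \bar R}.
Implicit Types w rho phi psi : Y -> R.
Local Notation integ phi := (mu.-integrable [set: Y] (EFin \o phi)).

Lemma cvg_Rintegral_dominated (D : set Y) (u : nat -> Y -> R) (v g : Y -> R) :
  measurable D -> (forall n, measurable_fun D (u n)) -> measurable_fun D v ->
  (forall y, D y -> u n y @[n --> \oo] --> v y) ->
  mu.-integrable D (EFin \o g) -> (forall n y, D y -> `|u n y| <= g y) ->
  \int[mu]_(y in D) u n y @[n --> \oo] --> \int[mu]_(y in D) v y.
Proof.
move=> mD mu_ mv uv ig ug; apply: fine_cvg.
have [||||| iv _ h] := @dominated_convergence _ _ _ mu D mD
  (fun n => EFin \o u n) (EFin \o v) (EFin \o g).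
- by move=> n; exact/measurable_EFinP.
- exact/measurable_EFinP.
- apply: aeW => y Dy; apply: cvg_EFin; last exact: uv.
  exact: nearW.
- exact: ig.
- by apply: aeW => y n Dy; rewrite /= lee_fin; exact: ug.
rewrite fineK; first exact: h.
exact: integrable_fin_num.
Qed.

Lemma integrable_measurable rho : integ rho -> measurable_fun setT rho.
Proof. by move=> /(measurable_int mu)/measurable_EFinP. Qed.

Lemma integrable_fun_add phi psi : integ phi -> integ psi ->
  integ (fun y => phi y + psi y).
Proof. by move=> iphi ipsi; exact: (integrableD measurableT iphi ipsi). Qed.

Lemma integrable_fun_scale k phi : integ phi -> integ (fun y => k * phi y).
Proof. by move=> iphi; exact: (integrableZl measurableT k iphi). Qed.

Lemma integrable_fun_sub phi psi : integ phi -> integ psi ->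
  integ (fun y => phi y - psi y).
Proof. by move=> iphi ipsi; exact: (integrableB measurableT iphi ipsi). Qed.

Lemma integrable_bounded_mul w rho : measurable_fun setT w ->
  (forall y, `|w y| <= 1) -> integ rho -> integ (fun y => w y * rho y).
Proof.
move=> mw w1 ir; have mr := integrable_measurable ir.
apply: le_integrable ir => //.
  by apply/measurable_EFinP; apply: measurable_funM.

by move=> y _ /=; rewrite lee_fin normrM ler_piMl.
Qed.

(** Lets a vanishing integral of a nonnegative function be used without
    speaking of almost everywhere equality. *)
Lemma Rintegral_eq0_eq0 phi psi : integ phi -> (forall y, 0 <= phi y) ->
  \int[mu]_y phi y = 0 -> measurable_fun setT psi ->
  (forall y, phi y = 0 -> psi y = 0) -> \int[mu]_y psi y = 0.
Proof.
move=> iphi phi0 Iphi mpsi phipsi.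
have mphi := measurable_int mu iphi.
have ae0 : ae_eq mu setT (EFin \o phi) (cst 0%E).
  apply/ae_eq_integral_abs => //.
  under eq_integral do rewrite /= ger0_norm//.
  apply/eqP; rewrite -fine_eq0; last exact: integrable_fin_num.
  exact/eqP.
rewrite /Rintegral (@ae_eq_integral _ _ _ mu setT (cst 0%E)) ?integral0//.
  exact/measurable_EFinP.
apply: filterS ae0 => y /(_ I) /= [phiy0] _; congr EFin; exact: phipsi.
Qed.

End real_integration.

(** * Randomized lower-tail tests of prescribed mass *)

Section lower_tail.
Context d (Y : measurableType d) (R : realType).
Variables (mu : {measure set Y -> \bar R}) (f T : Y -> R).
Hypothesis f_int : mu.-integrable [set: Y] (EFin \o f).
Hypothesis f_ge0 : forall y, 0 <= f y.
Hypothesis f_mass1 : \int[mu]_y f y = 1.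
Hypothesis T_meas : measurable_fun [set: Y] T.

Definition below (t : R) : R := \int[mu]_y ((T y <= t)%R%:R * f y).
Definition strictly_below (t : R) : R := \int[mu]_y ((T y < t)%R%:R * f y).

Lemma measurable_boolR (b : Y -> bool) : measurable_fun [set: Y] b ->
  measurable_fun [set: Y] (fun y => (b y)%:R : R).
Proof.
by move=> mb; exact: (@measurableT_comp _ _ _ _ _ _ (fun b : bool => b%:R : R)).
Qed.

Lemma measurable_le_cst t : measurable_fun [set: Y] (fun y => (T y <= t)%R%:R : R).
Proof. by apply: measurable_boolR; exact: measurable_fun_ler. Qed.

Lemma measurable_lt_cst t : measurable_fun [set: Y] (fun y => (T y < t)%R%:R : R).
Proof. by apply: measurable_boolR; exact: measurable_fun_ltr. Qed.

Lemma normr_bool_le1 (b : bool) : `|b%:R : R| <= 1.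
Proof. by case: b; rewrite ?normr1 ?normr0. Qed.

Lemma le_cst_integrable t :
  mu.-integrable [set: Y] (EFin \o (fun y => (T y <= t)%R%:R * f y)).
Proof.
apply: integrable_bounded_mul => //; first exact: measurable_le_cst.
by move=> y; exact: normr_bool_le1.
Qed.

Lemma lt_cst_integrable t :
  mu.-integrable [set: Y] (EFin \o (fun y => (T y < t)%R%:R * f y)).
Proof.
apply: integrable_bounded_mul => //; first exact: measurable_lt_cst.
by move=> y; exact: normr_bool_le1.
Qed.

Lemma below_nondecreasing t t' : t <= t' -> below t <= below t'.
Proof.
move=> tt'; apply: le_Rintegral => //; try exact: le_cst_integrable.
move=> y _; rewrite ler_wpM2r// ler_nat.
by case: (leP (T y) t) => // /le_trans -> .
Qed.

(** Dominated convergence in the form needed at a quantile: the indicators of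
    T <= t_n are only required to be eventually stationary at each point. *)
Lemma cvg_below (t : nat -> R) (g : Y -> R) :
  measurable_fun [set: Y] g ->
  (forall y, \forall n \near \oo, (T y <= t n)%R%:R = g y) ->
  below (t n) @[n --> \oo] --> \int[mu]_y (g y * f y).
Proof.
move=> mg tg; have mf := integrable_measurable f_int.
apply: (@cvg_Rintegral_dominated _ _ _ _ _ _ _ f) => //.
- by move=> n; apply: measurable_funM => //; exact: measurable_le_cst.
- exact: measurable_funM.
- move=> y _; apply: cvg_near_cst; near do rewrite (near (tg y) _)//.
- move=> n y _; rewrite normrM (ger0_norm (f_ge0 y)) ler_piMl//.
  exact: normr_bool_le1.
Unshelve. all: by end_near. Qed.

Definition quantile (s : R) : R := inf [set t | s <= below t].

Section quantile_theory.
Variable s : R.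
Hypothesis s01 : 0 < s < 1.

Let S : set R := [set t | s <= below t].

Let S_nonempty : S !=set0.
Proof.
have h : below n%:R @[n --> \oo] --> (1 : R).
  have e : \int[mu]_y (cst 1 y * f y) = 1.
    by rewrite -[RHS]f_mass1; apply: eq_Rintegral => y _; rewrite mul1r.
  rewrite -[X in _ --> X]e; apply: cvg_below => // y.
  near=> n; suff -> : (T y <= n%:R)%R by [].
  by near: n; exact: nbhs_infty_ger.
case/andP: s01 => _ s1.
have [n _ /(_ n (leqnn n)) sn] := cvgr_ge _ h _ s1.
by exists n%:R.
Unshelve. all: by end_near. Qed.

Let S_lbound : has_lbound S.
Proof.
have h : below (- n%:R) @[n --> \oo] --> (0 : R).
  have -> : 0 = \int[mu]_y (cst 0 y * f y) :> R.
    under eq_Rintegral do rewrite mul0r.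
    by rewrite /Rintegral integral0.
  apply: cvg_below => // y.
  near=> n; suff -> : ((T y <= - n%:R) = false)%R by [].
  apply/negbTE; rewrite -ltNge ltrNl.
  by near: n; exact: nbhs_infty_gtr.
case/andP: s01 => s0 _.
have [n _ /(_ n (leqnn n)) /= sn] := cvgr_lt _ h _ s0.
exists (- n%:R) => t /= st; rewrite leNgt; apply/negP => /ltW tn.
by have := lt_le_trans sn (le_trans st (below_nondecreasing tn)); rewrite ltxx.
Unshelve. all: by end_near. Qed.

Lemma le_below_quantile : s <= below (quantile s).
Proof.
have h : below (quantile s + n.+1%:R^-1) @[n --> \oo] --> below (quantile s).
  apply: cvg_below => [|y]; first exact: measurable_le_cst.
  have [Ty|Ty] := leP (T y) (quantile s).
    by apply: nearW => n; rewrite (le_trans Ty)// lerDl.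
  near=> n; suff -> : ((T y <= quantile s + n.+1%:R^-1) = false)%R by [].
  apply/negbTE; rewrite -ltNge -ltrBrDl.
  by near: n; apply: (near_infty_natSinv_lt (PosNum _)); rewrite subr_gt0.
apply: (cvgr_to_ge h).
apply: nearW => n.
have n0 : 0 < n.+1%:R^-1 :> R by [].
have [t /= st tq] := inf_adherent n0 (conj S_nonempty S_lbound).
exact: le_trans st (below_nondecreasing (ltW tq)).
Unshelve. all: by end_near. Qed.

Lemma strictly_below_quantile_le : strictly_below (quantile s) <= s.
Proof.
have h : below (quantile s - n.+1%:R^-1) @[n --> \oo]
    --> strictly_below (quantile s).
  apply: cvg_below => [|y]; first exact: measurable_lt_cst.
  have [Ty|Ty] := ltP (T y) (quantile s); last first.
    apply: nearW => n; suff -> : ((T y <= quantile s - n.+1%:R^-1) = false)%R by [].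
    by apply/negbTE; rewrite -ltNge (lt_le_trans _ Ty)// ltrBlDr ltrDl.
  near=> n; suff -> : (T y <= quantile s - n.+1%:R^-1)%R by [].
  rewrite lerBrDl -lerBrDr; apply: ltW.
  by near: n; apply: (near_infty_natSinv_lt (PosNum _)); rewrite subr_gt0.
apply: (cvgr_to_le h).
apply: nearW => n; rewrite leNgt; apply/negP => /ltW sn.
have /(ge_inf S_lbound) : S (quantile s - n.+1%:R^-1) by [].
by rewrite -/(quantile s) lerDl oppr_ge0 leNgt invr_gt0 ltr0Sn.
Unshelve. all: by end_near. Qed.

Lemma quantile_lbound t : s <= below t -> quantile s <= t.
Proof. by move=> st; exact: ge_inf. Qed.

End quantile_theory.


Lemma quantile_nondecreasing s s' : 0 < s -> s' < 1 -> s <= s' ->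
  quantile s <= quantile s'.
Proof.
move=> s0 s'1 ss'; apply: quantile_lbound.
  by rewrite s0 (le_lt_trans ss').
apply: (le_trans ss'); apply: le_below_quantile.
by rewrite s'1 (lt_le_trans s0).
Qed.

(** The randomization on {T = quantile s} that makes the mass of the test
    exactly s. When that set is null the weight is 0 / 0 = 0. *)
Definition atom_weight (s : R) : R :=
  (s - strictly_below (quantile s))
    / (below (quantile s) - strictly_below (quantile s)).

Lemma atom_weight_ge0_le1 s : 0 < s < 1 -> 0 <= atom_weight s <= 1.
Proof.
move=> s01; rewrite /atom_weight.
have sb := le_below_quantile s01; have bs := strictly_below_quantile_le s01.
have [bb|bb] := eqVneq (below (quantile s)) (strictly_below (quantile s)).
  by rewrite bb subrr invr0 mulr0 lexx ler01.
have bb0 : 0 < below (quantile s) - strictly_below (quantile s).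
  by rewrite subr_gt0 lt_neqAle eq_sym bb (le_trans bs).
rewrite divr_ge0 ?subr_ge0 ?(le_trans bs)//=.
by rewrite ler_pdivrMr// mul1r lerD2r.
Qed.

(** Tests defined for every real s, constant outside [0, 1]: this makes the
    family continuous on the whole line, endpoints included. *)
Definition lower_test (s : R) (y : Y) : R :=
  if s <= 0 then 0 else if 1 <= s then 1 else
  if T y < quantile s then 1 else if quantile s < T y then 0 else atom_weight s.

Definition cutoff (s : R) : \bar R :=
  if s <= 0 then -oo%E else if 1 <= s then +oo%E else (quantile s)%:E.

Lemma lower_test_le0 s y : s <= 0 -> lower_test s y = 0.
Proof. by rewrite /lower_test => ->. Qed.

Lemma lower_test_ge1 s y : 1 <= s -> lower_test s y = 1.
Proof.
by move=> s1; rewrite /lower_test leNgt (lt_le_trans ltr01 s1) s1.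
Qed.

Lemma lower_test0 y : lower_test 0 y = 0.
Proof. exact: lower_test_le0. Qed.

Lemma lower_test1 y : lower_test 1 y = 1.
Proof. exact: lower_test_ge1. Qed.

Lemma lower_test_ge0_le1 s y : 0 <= lower_test s y <= 1.
Proof.
rewrite /lower_test; case: ifPn => [_|]; first by rewrite lexx ler01.
rewrite -ltNge => s0; case: ifPn => [_|]; first by rewrite ler01 lexx.
rewrite -ltNge => s1; case: ifPn => _; first by rewrite ler01 lexx.
case: ifPn => _; first by rewrite lexx ler01.
by apply: atom_weight_ge0_le1; rewrite s0.
Qed.

Lemma lower_test_lt_cutoff s y : ((T y)%:E < cutoff s)%E -> lower_test s y = 1.
Proof.
rewrite /lower_test /cutoff; case: ifPn => [_|_]; first by rewrite ltNge leNye.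
by case: ifPn => // _; rewrite lte_fin => ->.
Qed.

Lemma lower_test_gt_cutoff s y : (cutoff s < (T y)%:E)%E -> lower_test s y = 0.
Proof.
rewrite /lower_test /cutoff; case: ifPn => [//|_].
case: ifPn => [_|_]; first by rewrite ltNge leey.
by rewrite lte_fin => Ty; rewrite ltNge (ltW Ty)/= Ty.
Qed.

Lemma cutoff_nondecreasing s s' : s <= s' -> (cutoff s <= cutoff s')%E.
Proof.
move=> ss'; rewrite /cutoff.
case: ifPn => [_|]; first by rewrite leNye.
rewrite -ltNge => s0; rewrite (leNgt s') (lt_le_trans s0 ss')/=.
have [_|s'1] := leP 1 s'; first by rewrite leey.
rewrite (leNgt 1 s) (le_lt_trans ss' s'1)/= lee_fin.
exact: quantile_nondecreasing.
Qed.

(** Tests with different cutoffs are ordered by the cutoffs; with a common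
    cutoff the order is that of the weights on the atom. *)
Lemma lower_test_nondecreasing s s' y : s <= s' ->
  lower_test s y <= lower_test s' y.
Proof.
move=> ss'; have /andP[L0 L1] := lower_test_ge0_le1 s' y.
have /andP[K0 K1] := lower_test_ge0_le1 s y.
have cc := cutoff_nondecreasing ss'.
have [Ts'|Ts'] := ltP (T y)%:E (cutoff s'); first by rewrite (lower_test_lt_cutoff Ts').
have [Ts|Ts] := ltP (cutoff s) (T y)%:E; first by rewrite (lower_test_gt_cutoff Ts).
have : (T y)%:E = cutoff s by apply/eqP; rewrite eq_le Ts (le_trans cc).
have : (T y)%:E = cutoff s' by apply/eqP; rewrite eq_le Ts' (le_trans Ts).
rewrite /cutoff /lower_test.
have [//|s'0] := leP s' 0; have [//|s'1] := leP 1 s'.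
have [//|s0] := leP s 0; have [//|s1] := leP 1 s.
move=> [e'] [e]; rewrite -e -e' ltxx /atom_weight -e -e'.
have [bb|bb] := eqVneq (below (T y)) (strictly_below (T y)).
  by rewrite bb subrr invr0 !mulr0.
rewrite ler_wpM2r// ?lerD2r// invr_ge0 subr_ge0.
have := le_below_quantile (introT andP (conj s0 s1)).
have := strictly_below_quantile_le (introT andP (conj s0 s1)).
by rewrite -e; exact: le_trans.
Qed.

Lemma lower_test_measurable s : measurable_fun [set: Y] (lower_test s).
Proof.
rewrite /lower_test; case: (s <= 0); first exact: measurable_cst.
case: (1 <= s); first exact: measurable_cst.
apply: measurable_fun_ifT => //; first exact: measurable_fun_ltr.
by apply: measurable_fun_ifT => //; exact: measurable_fun_ltr.
Qed.

Lemma normr_lower_test_le1 s y : `|lower_test s y| <= 1.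
Proof. by have /andP[L0 L1] := lower_test_ge0_le1 s y; rewrite ger0_norm. Qed.

Lemma lower_test_integrable s rho : mu.-integrable [set: Y] (EFin \o rho) ->
  mu.-integrable [set: Y] (EFin \o (fun y => lower_test s y * rho y)).
Proof.
apply: integrable_bounded_mul; first exact: lower_test_measurable.
exact: normr_lower_test_le1.
Qed.

(** The mass strictly below the quantile is at most s and the mass up to it
    is at least s; the weight on the atom interpolates between the two. *)
Lemma lower_test_mass s : 0 <= s <= 1 -> \int[mu]_y (lower_test s y * f y) = s.
Proof.
case/andP=> s0 s1; move: (s0); rewrite le_eqVlt => /predU1P[<-|{}s0].
  under eq_Rintegral do rewrite lower_test0 mul0r.
  by rewrite /Rintegral integral0.
move: (s1); rewrite le_eqVlt => /predU1P[->|{}s1].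
  by under eq_Rintegral do rewrite lower_test1 mul1r.
have s01 : 0 < s < 1 by rewrite s0.
transitivity (strictly_below (quantile s)
    + atom_weight s * (below (quantile s) - strictly_below (quantile s))).
  rewrite -RintegralB//; [|exact: le_cst_integrable|exact: lt_cst_integrable].
  have iB := integrable_fun_sub (le_cst_integrable (quantile s))
    (lt_cst_integrable (quantile s)).
  rewrite -RintegralZl// -RintegralD//;
    [|exact: lt_cst_integrable|exact: integrable_fun_scale].
  apply: eq_Rintegral => y _; rewrite /lower_test !leNgt s0 s1/=.
  by case: (ltgtP (T y) (quantile s)) => _ /=; ring.
have sb := le_below_quantile s01; have bs := strictly_below_quantile_le s01.
rewrite /atom_weight.
have [bb|bb] := eqVneq (below (quantile s)) (strictly_below (quantile s)).
  rewrite bb subrr mulr0 addr0; apply/eqP.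
  by rewrite eq_le bs -bb sb.
by rewrite divfK ?subr_eq0// addrC subrK.
Qed.

End lower_tail.

(* Otherwise unification unfolds the tests when it compares integrands. *)
Global Opaque lower_test.

(** * Two-sided tests and their continuity *)

Section outer_tests.
Context d (Y : measurableType d) (R : realType).
Variables (mu : {measure set Y -> \bar R}) (f T : Y -> R).
Hypothesis f_int : mu.-integrable [set: Y] (EFin \o f).
Hypothesis f_ge0 : forall y, 0 <= f y.
Hypothesis f_mass1 : \int[mu]_y f y = 1.
Hypothesis T_meas : measurable_fun [set: Y] T.

Local Notation L := (lower_test mu f T).
Local Notation integ phi := (mu.-integrable [set: Y] (EFin \o phi)).
Let L_ge0_le1 s y : 0 <= L s y <= 1.
Proof. exact: (lower_test_ge0_le1 f_int f_ge0 f_mass1 T_meas). Qed.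
Let L_meas s : measurable_fun [set: Y] (L s).
Proof. exact: lower_test_measurable. Qed.

(** Uniform absolute continuity: where |rho| <= M f the integral is controlled
    by that of w f, and the integral of |rho| over the rest is at most e once M
    is large. *)
Lemma integral_mul_le_affine (rho : Y -> R) (e : R) : 0 < e -> integ rho ->
  (forall y, f y = 0 -> rho y = 0) ->
  exists2 M, 0 <= M & forall w : Y -> R, measurable_fun [set: Y] w ->
    (forall y, 0 <= w y <= 1) ->
    \int[mu]_y (w y * `|rho y|) <= M * \int[mu]_y (w y * f y) + e.
Proof.
move=> e0 irho rho0.
have mrho := integrable_measurable irho; have mf := integrable_measurable f_int.
have iar : integ (fun y => `|rho y|) by exact: (integrable_norm irho).
have mar := integrable_measurable iar.
pose b n y := (n%:R * f y < `|rho y|)%R%:R : R.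
have mb n : measurable_fun [set: Y] (b n).
  apply: measurable_boolR; apply: measurable_fun_ltr => //.
  exact: measurable_funM.
have ib n : integ (fun y => b n y * `|rho y|).
  by apply: integrable_bounded_mul => // y; exact: normr_bool_le1.
have : \int[mu]_y (b n y * `|rho y|) @[n --> \oo] --> \int[mu]_y (cst 0 y : R).
  apply: (@cvg_Rintegral_dominated _ _ _ _ _ _ _ (fun y => `|rho y|)) => //.
  - by move=> n; exact: measurable_funM.
  - move=> y _; apply: cvg_near_cst.
    have [fy|fy] := eqVneq (f y) 0.
      by apply: nearW => n; rewrite /b rho0// normr0 mulr0.
    have fy0 : 0 < f y by rewrite lt_neqAle eq_sym fy f_ge0.
    near=> n; rewrite /b ltNge.
    suff -> : (`|rho y| <= n%:R * f y)%R by rewrite mul0r.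
    rewrite -ler_pdivrMr//.
    by near: n; exact: nbhs_infty_ger.
  - move=> n y _; rewrite normrM normr_id ler_piMl//; exact: normr_bool_le1.
rewrite [X in _ --> X]/Rintegral integral0/= => h.
have [n _ /(_ n (leqnn n)) /= hn] := cvgr_lt _ h _ e0.
exists n%:R => // w mw w01.
have w1 y : `|w y| <= 1 by have /andP[? ?] := w01 y; rewrite ger0_norm.
have iwf := integrable_bounded_mul mw w1 f_int.
have iwr := integrable_bounded_mul mw w1 iar.
apply: (@le_trans _ _ (n%:R * \int[mu]_y (w y * f y)
    + \int[mu]_y (b n y * `|rho y|))); last by rewrite lerD2l ltW.
rewrite -RintegralZl// -RintegralD//; last exact: integrable_fun_scale.
apply: le_Rintegral => //.
  by apply: integrable_fun_add => //; exact: integrable_fun_scale.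
move=> y _; have /andP[w0 wle1] := w01 y; rewrite /b.
have [rn|rn] := leP (`|rho y|) (n%:R * f y).
  by rewrite mul0r addr0 mulrCA ler_wpM2l.
by rewrite mul1r ler_wpDl ?ler_piMl// mulr_ge0// mulr_ge0.
Unshelve. all: by end_near. Qed.

Let normr_distL_le1 s s' y : `|L s' y - L s y| <= 1.
Proof.
move: (L s y) (L s' y) (L_ge0_le1 s y) (L_ge0_le1 s' y).
by move=> a b /andP[? ?] /andP[? ?]; rewrite ler_norml; apply/andP; lra.
Qed.

(** By monotonicity the L1 distance of two tests is the difference of their
    masses. *)
Lemma lower_test_dist_mass s s' :
  \int[mu]_y (`|L s' y - L s y| * f y) <= `|s' - s|.
Proof.
wlog ss' : s s' / s <= s'.
  move=> H; have [/H//|/ltW/H] := leP s s'.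
  rewrite (distrC s s'); apply: le_trans; rewrite le_eqVlt; apply/orP; left.
  by apply/eqP; apply: eq_Rintegral => y _; rewrite distrC.
have iL r := lower_test_integrable f_int f_ge0 f_mass1 T_meas r f_int.
have clipE r : \int[mu]_y (L r y * f y) = Num.max 0 (Num.min 1 r).
  have [r0|r0] := leP r 0.
    rewrite min_r ?(le_trans r0)// max_l//.
    under eq_Rintegral do rewrite lower_test_le0// mul0r.
    by rewrite /Rintegral integral0.
  have [r1|r1] := leP 1 r; last first.
    by rewrite max_r ?ltW// lower_test_mass// !ltW.
  rewrite max_r// -f_mass1.
  by apply: eq_Rintegral => y _; rewrite lower_test_ge1// mul1r.
have -> : \int[mu]_y (`|L s' y - L s y| * f y)
    = \int[mu]_y (L s' y * f y) - \int[mu]_y (L s y * f y).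
  rewrite -RintegralB//; apply: eq_Rintegral => y _.
  by rewrite ger0_norm ?mulrBl// subr_ge0 lower_test_nondecreasing.
rewrite !clipE ger0_norm ?subr_ge0//.
rewrite /Num.max /Num.min.
by case: (ltP 1 s) => ?; case: (ltP 1 s') => ?;
  case: ltP => ?; case: ltP => ?; lra.
Qed.

(** For s <= v this is 1 - (L v - L s), which accepts between the quantiles of
    orders s and v. The maximum makes it a decision rule for all s and v. *)
Definition outer_test (s v : R) (y : Y) : R := 1 - Num.max 0 (L v y - L s y).

Lemma outer_test_measurable s v : measurable_fun [set: Y] (outer_test s v).
Proof.
apply: measurable_funB => //; apply: measurable_maxr => //.
exact: measurable_funB.
Qed.

Lemma outer_test_ge0_le1 s v y : 0 <= outer_test s v y <= 1.
Proof.
rewrite /outer_test; move: (L s y) (L v y) (L_ge0_le1 s y) (L_ge0_le1 v y).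
by move=> a b /andP[? ?] /andP[? ?]; case: (leP 0 (b - a)) => ?; apply/andP; lra.
Qed.

Lemma outer_test_decision_rule s v : decision_rule (outer_test s v).
Proof. by split; [exact: outer_test_measurable|exact: outer_test_ge0_le1]. Qed.

Lemma outer_testE s v y : s <= v -> outer_test s v y = 1 - (L v y - L s y).
Proof.
move=> sv; rewrite /outer_test max_r// subr_ge0.
exact: (lower_test_nondecreasing f_int f_ge0 f_mass1 T_meas).
Qed.

Lemma outer_test_ge s v y : v <= s -> outer_test s v y = 1.
Proof.
move=> vs; rewrite /outer_test max_l ?subr0// subr_le0.
exact: (lower_test_nondecreasing f_int f_ge0 f_mass1 T_meas).
Qed.

Lemma outer_test_dist s v s' v' y : `|outer_test s v y - outer_test s' v' y|
  <= `|L v y - L v' y| + `|L s y - L s' y|.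
Proof.
rewrite /outer_test; move: (L s y) (L v y) (L s' y) (L v' y) => a b a' b'.
have /andP[? ?] : - `|b - b'| <= b - b' <= `|b - b'| by rewrite -ler_norml.
have /andP[? ?] : - `|a - a'| <= a - a' <= `|a - a'| by rewrite -ler_norml.
by case: (leP 0 (b - a)); case: (leP 0 (b' - a')) => ? ?;
  rewrite ler_norml; apply/andP; lra.
Qed.

Lemma rule_mul_integrable (w rho : Y -> R) :
  decision_rule w -> integ rho -> integ (fun y => w y * rho y).
Proof.
move=> [mw w01]; apply: integrable_bounded_mul => // y.
by have /andP[? ?] := w01 y; rewrite ger0_norm.
Qed.

(** The tests do not converge pointwise when a quantile jumps, but the L1
    distance with weight f is Lipschitz in the parameters, and uniform absolute
    continuity transfers this to every weight that vanishes where f does. *)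
Lemma continuous_outer_test (rho : Y -> R) : integ rho ->
  (forall y, f y = 0 -> rho y = 0) ->
  continuous (fun z : R * R => \int[mu]_y (outer_test z.1 z.2 y * rho y)).
Proof.
move=> irho rho0 z; apply/cvgrPdist_le => e e0.
have e4 : 0 < e / 4 by rewrite divr_gt0.
have [M M0 HM] := integral_mul_le_affine e4 irho rho0.
have dL s s' : \int[mu]_y (`|L s' y - L s y| * `|rho y|) <= M * `|s' - s| + e / 4.
  apply: le_trans (HM (fun y => `|L s' y - L s y|) _ _) _.
  - by apply: measurableT_comp => //; exact: measurable_funB.
  - by move=> y; rewrite normr_ge0 normr_distL_le1.
  - by rewrite lerD2r ler_wpM2l// lower_test_dist_mass.
have iar : integ (fun y => `|rho y|) by exact: (integrable_norm irho).
have iL s s' : integ (fun y => `|L s' y - L s y| * `|rho y|).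
  apply: integrable_bounded_mul => //.
    by apply: measurableT_comp => //; exact: measurable_funB.
  by move=> y; rewrite normr_id normr_distL_le1.
(* M + 1 rather than M, since M may be 0 *)
have d0 : 0 < e / 4 / (M + 1) by rewrite divr_gt0// ltr_wpDl.
have dM t : `|t| <= e / 4 / (M + 1) -> M * `|t| <= e / 4.
  move=> td; apply: (@le_trans _ _ ((M + 1) * `|t|)).
    by rewrite ler_wpM2r// lerDl.
  by rewrite mulrC -ler_pdivlMr// ltr_wpDl.
near=> z'.
have iO s v := rule_mul_integrable (outer_test_decision_rule s v) irho.
rewrite -RintegralB//.
apply: le_trans
  (le_normr_Rintegral measurableT (integrable_fun_sub (iO _ _) (iO _ _))) _.
apply: (@le_trans _ _ (\int[mu]_y (`|L z.2 y - L z'.2 y| * `|rho y|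
    + `|L z.1 y - L z'.1 y| * `|rho y|))).
  apply: le_Rintegral => //.
  - exact: (integrable_norm (integrable_fun_sub (iO z.1 z.2) (iO z'.1 z'.2))).
  - by apply: integrable_fun_add; exact: iL.
  - by move=> y _; rewrite -mulrBl normrM -mulrDl ler_wpM2r// outer_test_dist.
rewrite RintegralD//.
have g1 : M * `|z.1 - z'.1| <= e / 4.
  by apply: dM; near: z'; apply: cvgr_dist_le => //; exact: cvg_fst.
have g2 : M * `|z.2 - z'.2| <= e / 4.
  by apply: dM; near: z'; apply: cvgr_dist_le => //; exact: cvg_snd.
rewrite (_ : e = e / 4 + e / 4 + (e / 4 + e / 4)); last by field.
by apply: lerD; apply: le_trans (dL _ _) _; rewrite lerD2r.
Unshelve. all: by end_near. Qed.

End outer_tests.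

Global Opaque outer_test.

(** * Convexity of one function with respect to another *)

Section relative_convexity.
Context (R : realType).
Implicit Types x psi : R -> R.

(** psi is a convex function of x, expressed by the existence of subgradients.
    No inverse of x is involved. *)
Definition convex_in x psi := forall t0, exists k, forall t,
  k * (x t - x t0) <= psi t - psi t0.

(** The affine function of x is the chord of psi between l and u. It is compared
    with psi by the subgradient at l on the left, at u on the right, and at the
    point itself in between. *)
Lemma convex_in_chord x psi (l u : R) :
  {homo x : s t / s < t} -> convex_in x psi -> l < u ->
  exists alpha beta,
    (forall t, t <= l \/ u <= t -> alpha + beta * x t <= psi t)
    /\ (forall t, l <= t <= u -> psi t <= alpha + beta * x t).
Proof.
move=> xinc cvx lu; have xlu := xinc _ _ lu; have xmono := ltW_homo xinc.
pose beta := (psi u - psi l) / (x u - x l).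
have betaE : beta * (x u - x l) = psi u - psi l.
  by rewrite divfK// subr_eq0 gt_eqF.
exists (psi l - beta * x l), beta; split=> t.
  case=> [tl|ut].
    have [k /[dup] /(_ u) ku /(_ t) kt] := cvx l; have xtl := xmono _ _ tl.
    have kb : k <= beta by rewrite -(@ler_pM2r _ (x u - x l)) ?betaE// subr_gt0.
    have : (beta - k) * (x t - x l) <= 0.
      by rewrite mulr_ge0_le0 ?subr_ge0// subr_le0.
    by lra.
  have [k /[dup] /(_ l) kl /(_ t) kt] := cvx u; have xut := xmono _ _ ut.
  have kb : beta <= k.
    by rewrite -(@ler_pM2r _ (x u - x l)) ?betaE ?subr_gt0//; lra.
  have : 0 <= (k - beta) * (x t - x u) by rewrite mulr_ge0 ?subr_ge0.
  by lra.
case/andP=> lt tu; have [k /[dup] /(_ l) kl /(_ u) ku] := cvx t.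
have xlt := xmono _ _ lt; have xtu := xmono _ _ tu.
rewrite -(@ler_pM2r _ (x u - x l)) ?subr_gt0//.
have -> : (psi l - beta * x l + beta * x t) * (x u - x l)
    = psi l * (x u - x l) + (x t - x l) * (beta * (x u - x l)) by ring.
rewrite betaE.
have := @ler_wpM2l _ (x u - x t) _ _ _ kl; rewrite subr_ge0 xtu => /(_ isT).
have := @ler_wpM2l _ (x t - x l) _ _ _ ku; rewrite subr_ge0 xlt => /(_ isT).
by lra.
Qed.

(** Jensen's inequality for two points with unnormalized weights, from the
    tangent at their barycenter. *)
Lemma expR_convex_comb (p q X Z : R) : 0 <= p -> 0 <= q ->
  (p + q) * expR ((p * X + q * Z) / (p + q)) <= p * expR X + q * expR Z.
Proof.
move=> p0 q0; have [pq|pq] := eqVneq (p + q) 0.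
  by rewrite pq mul0r addr_ge0// mulr_ge0 ?expR_ge0.
set m := (_ / _).
have tangent t : expR m * (1 + (t - m)) <= expR t.
  by rewrite -[t in leRHS](subrKC m) expRD ler_wpM2l ?expR_ge0// expR_ge1Dx.
have mE : (p + q) * m = p * X + q * Z by rewrite mulrC divfK.
have e : (p + q) * expR m
    = p * (expR m * (1 + (X - m))) + q * (expR m * (1 + (Z - m))).
  have -> : p * (expR m * (1 + (X - m))) + q * (expR m * (1 + (Z - m)))
    = (p + q) * expR m + (p * X + q * Z - (p + q) * m) * expR m by ring.
  by rewrite mE subrr mul0r addr0.
by rewrite e lerD// ler_wpM2l.
Qed.

Lemma expR_convex_in_id c : convex_in id (fun t : R => expR (c * t)).
Proof.
move=> t0; exists (c * expR (c * t0)) => t.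
have -> : expR (c * t) = expR (c * t0) * expR (c * (t - t0)).
  by rewrite -expRD; congr expR; ring.
have := @ler_wpM2l _ (expR (c * t0)) (expR_ge0 _) _ _ (expR_ge1Dx (c * (t - t0))).
by lra.
Qed.

(** Translating the argument multiplies exponentials by constants, so it is
    enough to have a subgradient at 0; c / e is the derivative of r^(c/e) at
    r = 1. The sign k lets one lemma serve convexity and concavity. *)
Lemma convex_in_expR (e c k : R) :
  (forall t, k * (c / e * (expR (e * t) - 1)) <= k * (expR (c * t) - 1)) ->
  convex_in (fun t => expR (e * t)) (fun t => k * expR (c * t)).
Proof.
move=> H t0; exists (k * (c / e) * expR ((c - e) * t0)) => t.
have h r : expR (r * t) = expR (r * t0) * expR (r * (t - t0)).
  by rewrite -expRD; congr expR; ring.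
rewrite (h e) (h c).
have ee : expR ((c - e) * t0) * expR (e * t0) = expR (c * t0).
  by rewrite -expRD; congr expR; ring.
have -> : k * (c / e) * expR ((c - e) * t0)
    * (expR (e * t0) * expR (e * (t - t0)) - expR (e * t0))
  = expR (c * t0) * (k * (c / e * (expR (e * (t - t0)) - 1))).
  by rewrite -ee; ring.
have -> : k * (expR (c * t0) * expR (c * (t - t0))) - k * expR (c * t0)
  = expR (c * t0) * (k * (expR (c * (t - t0)) - 1)) by ring.
by rewrite ler_wpM2l// expR_ge0.
Qed.

(** In terms of r = exp(e t) the function is r^(c/e), whose exponent lies
    outside ]0, 1[. *)
Lemma expR_convex_in_expR (e c : R) : 0 < e -> c <= 0 \/ e <= c ->
  convex_in (fun t => expR (e * t)) (fun t => expR (c * t)).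
Proof.
move=> e0 ec.
have -> : (fun t => expR (c * t)) = (fun t => 1 * expR (c * t)).
  by apply/funext => t; rewrite mul1r.
apply: convex_in_expR => t; rewrite !mul1r mulrAC ler_pdivrMr//.
case: ec => ce.
  (* 0 is a convex combination of c t and e t *)
  have := @expR_convex_comb e (- c) (c * t) (e * t) (ltW e0).
  rewrite (_ : e * (c * t) + - c * (e * t) = 0); last by ring.
  by rewrite mul0r expR0 oppr_ge0 => /(_ ce); lra.
(* e t is a convex combination of c t and 0 *)
have ce0 : 0 <= c - e by rewrite subr_ge0.
have c0 : c != 0 by rewrite gt_eqF// (lt_le_trans e0).
have := @expR_convex_comb e (c - e) (c * t) 0 (ltW e0) ce0.
rewrite mulr0 addr0 subrKC expR0.
have -> : e * (c * t) / c = e * t by field.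
by lra.
Qed.

(** The same power function with an exponent in [0, 1]. *)
Lemma expR_concave_in_expR (e c : R) : 0 < e -> 0 <= c <= e ->
  convex_in (fun t => expR (e * t)) (fun t => - expR (c * t)).
Proof.
move=> e0 /andP[c0 ce].
have -> : (fun t => - expR (c * t)) = (fun t => - 1 * expR (c * t)).
  by apply/funext => t; rewrite mulN1r.
apply: convex_in_expR => t.
rewrite !mulN1r lerN2 mulrAC ler_pdivlMr//.
(* c t is a convex combination of e t and 0 *)
have ec : 0 <= e - c by rewrite subr_ge0.
have := @expR_convex_comb c (e - c) (e * t) 0 c0 ec.
rewrite mulr0 addr0 subrKC expR0.
have -> : c * (e * t) / e = c * t by field; rewrite gt_eqF.
by lra.
Qed.

End relative_convexity.

(** * Moments of functions with few sign changes *)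

Section sign_changes.
Context d (Y : measurableType d) (R : realType).
Variables (mu : {measure set Y -> \bar R}) (f T : Y -> R).
Local Notation integ phi := (mu.-integrable [set: Y] (EFin \o phi)).
Hypothesis f_int : integ f.
Hypothesis f_ge0 : forall y, 0 <= f y.

Variable w : Y -> R.
Hypothesis w_meas : measurable_fun [set: Y] w.
Hypothesis w_le1 : forall y, `|w y| <= 1.
Hypothesis w_f : \int[mu]_y (w y * f y) = 0.

Let w_int (rho : Y -> R) : integ rho -> integ (fun y => w y * rho y).
Proof. exact: integrable_bounded_mul. Qed.

Section two_functions.
Variables X Psi : Y -> R.
Hypothesis Xf_int : integ (fun y => X y * f y).
Hypothesis Psif_int : integ (fun y => Psi y * f y).

Lemma affine_moment (c0 c1 : R) :
  integ (fun y => w y * ((c0 + c1 * X y) * f y))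
  /\ \int[mu]_y (w y * ((c0 + c1 * X y) * f y))
       = c1 * \int[mu]_y (w y * (X y * f y)).
Proof.
have -> : (fun y => w y * ((c0 + c1 * X y) * f y))
    = (fun y => c0 * (w y * f y) + c1 * (w y * (X y * f y))).
  by apply/funext => y; ring.
split; first by apply: integrable_fun_add; apply: integrable_fun_scale; exact: w_int.
rewrite RintegralD//; [|exact/integrable_fun_scale/w_int..].
by rewrite !RintegralZl ?w_f ?mulr0 ?add0r//; exact: w_int.
Qed.

Lemma Rintegral_affine_le (c0 c1 : R) :
  (forall y, 0 <= w y * (Psi y - (c0 + c1 * X y))) ->
  c1 * \int[mu]_y (w y * (X y * f y)) <= \int[mu]_y (w y * (Psi y * f y)).
Proof.
move=> wpos; have [iA <-] := affine_moment c0 c1.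
apply: le_Rintegral => //; first exact: w_int.
move=> y _; rewrite -subr_ge0.
have -> : w y * (Psi y * f y) - w y * ((c0 + c1 * X y) * f y)
  = w y * (Psi y - (c0 + c1 * X y)) * f y by ring.
by rewrite mulr_ge0.
Qed.

(** A function w that has the sign of an affine function of X, and is
    orthogonal to it for the weight f, must vanish almost everywhere off the
    zero set of that affine function, and Psi is constant on this set. This settles the degenerate cases of infinite
    cutoffs. *)
Lemma Rintegral_affine_eq0 (c0 c1 k : R) :
  (forall y, 0 <= w y * (c0 + c1 * X y)) ->
  (forall y, c0 + c1 * X y = 0 -> Psi y = k) ->
  c1 * \int[mu]_y (w y * (X y * f y)) = 0 ->
  \int[mu]_y (w y * (Psi y * f y)) = 0.
Proof.
move=> wpos Psik c1X; have [iA IA] := affine_moment c0 c1.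
have iP := w_int Psif_int; have iwf := integrable_fun_scale k (w_int f_int).
have : \int[mu]_y (w y * (Psi y * f y) - k * (w y * f y)) = 0.
  apply: (Rintegral_eq0_eq0 iA).
  - by move=> y; rewrite mulrA mulr_ge0.
  - by rewrite IA.
  - exact: integrable_measurable (integrable_fun_sub iP iwf).
  - move=> y /eqP; rewrite !mulf_eq0 => /or3P[/eqP->|/eqP/Psik->|/eqP->]; ring.
by rewrite RintegralB// RintegralZl ?w_f ?mulr0 ?subr0//; exact: w_int.
Qed.

End two_functions.

Variables (x psi : R -> R).
Hypothesis x_incr : {homo x : s t / s < t}.
Hypothesis xf_int : integ (fun y => x (T y) * f y).

(** The Neyman-Pearson argument: w (x - x q) >= 0. If q is infinite then w has
    constant sign and integral 0. *)
Lemma one_sign_change (q : \bar R) :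
  (forall y, (q < (T y)%:E)%E -> 0 <= w y) ->
  (forall y, ((T y)%:E < q)%E -> w y <= 0) ->
  0 <= \int[mu]_y (w y * (x (T y) * f y)).
Proof.
case: q => [q| |] wpos wneg.
- rewrite -[leLHS](mul0r (\int[mu]_y (w y * (x (T y) * f y)))).
  apply: (@Rintegral_affine_le (fun y => x (T y)) (fun y => x (T y)) _ _ (x q))
    => // y; rewrite mul0r addr0.
  have [Tq|qT|->] := ltgtP (T y) q; last by rewrite subrr mulr0.
    by rewrite mulr_le0 ?wneg ?lte_fin// subr_le0 ltW// x_incr.
  by rewrite mulr_ge0 ?wpos ?lte_fin// subr_ge0 ltW// x_incr.
- rewrite (@Rintegral_affine_eq0 (fun y => x (T y)) (fun y => x (T y)) _ _ (- 1) 0 0)//.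
  + by move=> y; rewrite mul0r addr0 mulr_le0 ?wneg ?ltry.
  + by move=> y /eqP; rewrite mul0r addr0 oppr_eq0 oner_eq0.
  + by rewrite mul0r.
- rewrite (@Rintegral_affine_eq0 (fun y => x (T y)) (fun y => x (T y)) _ _ 1 0 0)//.
  + by move=> y; rewrite mul0r addr0 mulr1 wpos ?ltNyr.
  + by move=> y /eqP; rewrite mul0r addr0 oner_eq0.
  + by rewrite mul0r.
Qed.

Hypothesis psif_int : integ (fun y => psi (T y) * f y).
Hypothesis psi_convex : convex_in x psi.
Hypothesis w_xf : \int[mu]_y (w y * (x (T y) * f y)) = 0.

(** As w is orthogonal to 1 and x, any affine function of x may be subtracted
    from psi. With the chord between l and u, or a subgradient when l = u, the
    product of the difference with w is nonnegative. If l or u is infinite, w is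
    forced to vanish almost everywhere, except perhaps at the other cutoff. *)
Lemma two_sign_changes (l u : \bar R) : (l <= u)%E ->
  (forall y, ((T y)%:E < l)%E \/ (u < (T y)%:E)%E -> 0 <= w y) ->
  (forall y, (l < (T y)%:E < u)%E -> w y <= 0) ->
  0 <= \int[mu]_y (w y * (psi (T y) * f y)).
Proof.
have x_inj s t : x s = x t -> s = t.
  move=> e; have [/x_incr|/x_incr|//] := ltgtP s t; by rewrite e ltxx.
have degenerate c0 c1 t0 : (forall y, 0 <= w y * (c0 + c1 * x (T y))) ->
    (forall y, c0 + c1 * x (T y) = 0 -> T y = t0) ->
    0 <= \int[mu]_y (w y * (psi (T y) * f y)).
  move=> wpos ct; rewrite (@Rintegral_affine_eq0
    (fun y => x (T y)) (fun y => psi (T y)) _ _ c0 c1 (psi t0))//.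
    by move=> y /ct ->.
  by rewrite w_xf mulr0.
have comparison c0 c1 :
    (forall y, 0 <= w y * (psi (T y) - (c0 + c1 * x (T y)))) ->
    0 <= \int[mu]_y (w y * (psi (T y) * f y)).
  by move=> /Rintegral_affine_le; rewrite w_xf mulr0; apply.
have all_ge0 : (forall y, 0 <= w y) -> 0 <= \int[mu]_y (w y * (psi (T y) * f y)).
  move=> w0; apply: (degenerate 1 0 0) => y; rewrite mul0r addr0 ?mulr1//.
  by move=> /eqP; rewrite oner_eq0.
case: l => [l| |]; case: u => [u| |] //= lu wpos wneg.
- move: lu; rewrite lee_fin le_eqVlt => /predU1P[lu|lu].
    have [k kP] := psi_convex l.
    apply: (comparison (psi l - k * x l) k) => y.
    have [Tl|Tl] := eqVneq (T y) l; first by rewrite Tl subrK subrr mulr0.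
    rewrite mulr_ge0//.
      apply: wpos; rewrite -lu !lte_fin; apply/orP.
      by move: Tl; rewrite neq_lt.
    by have := kP (T y); lra.
  have [c0 [c1 [out ins]]] := convex_in_chord x_incr psi_convex lu.
  apply: (comparison c0 c1) => y.
  have chord t : t = l \/ t = u -> psi t = c0 + c1 * x t.
    move=> e; apply/eqP; rewrite eq_le ins ?out//.
      by case: e => ->; [left|right].
    by case: e => ->; rewrite lexx ltW.
  have [lT|Tl|<-] := ltgtP l (T y); last by rewrite chord ?subrr ?mulr0//; left.
    have [uT|Tu|<-] := ltgtP u (T y); last by rewrite chord ?subrr ?mulr0//; right.
      rewrite mulr_ge0// ?wpos ?subr_ge0 ?out ?lte_fin//; right=> //.
      exact: ltW.
    by rewrite mulr_le0// ?wneg ?subr_le0 ?ins ?lte_fin ?lT// !ltW.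
  rewrite mulr_ge0// ?wpos ?subr_ge0 ?out ?lte_fin//; left=> //.
  exact: ltW.
- apply: (degenerate (x l) (- 1) l) => y.
    have [lT|Tl|->] := ltgtP l (T y); last by rewrite mulN1r subrr mulr0.
      rewrite mulr_le0// ?wneg ?lte_fin ?lT ?ltry//.
      by rewrite mulN1r subr_le0 ltW// x_incr.
    rewrite mulr_ge0//; first by apply: wpos; left; rewrite lte_fin.
    by rewrite mulN1r subr_ge0 ltW// x_incr.
  by move=> /eqP; rewrite mulN1r subr_eq0 => /eqP/x_inj.
- by apply: all_ge0 => y; apply: wpos; left; rewrite ltry.
- apply: (degenerate (- x u) 1 u) => y.
    have [uT|Tu|->] := ltgtP u (T y); last by rewrite mul1r addNr mulr0.
      rewrite mulr_ge0//; first by apply: wpos; right; rewrite lte_fin.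
      by rewrite mul1r addrC subr_ge0 ltW// x_incr.
    rewrite mulr_le0// ?wneg ?lte_fin ?Tu ?ltNyr//.
    by rewrite mul1r addrC subr_le0 ltW// x_incr.
  by move=> /eqP; rewrite mul1r addrC subr_eq0 => /eqP/x_inj.
- apply: (degenerate (- 1) 0 0) => y; rewrite mul0r addr0.
    by rewrite mulr_le0 ?wneg ?ltNyr ?ltry.
  by move=> /eqP; rewrite oppr_eq0 oner_eq0.
- by apply: all_ge0 => y; apply: wpos; right; rewrite ltNyr.
Qed.

End sign_changes.

(** * Every rule is dominated by a two-sided test *)

Section domination.
Context d (Y : measurableType d) (R : realType).
Variables (mu : {measure set Y -> \bar R}) (f T : Y -> R).
Local Notation integ phi := (mu.-integrable [set: Y] (EFin \o phi)).
Hypothesis f_int : integ f.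
Hypothesis f_ge0 : forall y, 0 <= f y.
Hypothesis f_mass1 : \int[mu]_y f y = 1.
Hypothesis T_meas : measurable_fun [set: Y] T.

Local Notation L := (lower_test mu f T).
Local Notation O := (outer_test mu f T).
Local Notation cut := (cutoff mu f T).

Let O_rule s v : decision_rule (O s v).
Proof. exact: outer_test_decision_rule. Qed.

Lemma outer_test_two_sided s v : s <= v -> two_sided T (cut s) (cut v) (O s v) (O s v).
Proof.
move=> sv; have cc : (cut s <= cut v)%E by exact: cutoff_nondecreasing.
move=> y; split=> //; rewrite outer_testE//.
  case=> h.
    rewrite !lower_test_gt_cutoff// ?subr0//; exact: le_lt_trans h.
  rewrite !lower_test_lt_cutoff// ?subrr ?subr0//; exact: lt_le_trans cc.
case/andP=> ls vu.
by rewrite lower_test_lt_cutoff// lower_test_gt_cutoff// subr0 subrr.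
Qed.

Lemma outer_test_mass s v : 0 <= s -> s <= v -> v <= 1 ->
  \int[mu]_y (O s v y * f y) = 1 - (v - s).
Proof.
move=> s0 sv v1; have iL r := lower_test_integrable f_int f_ge0 f_mass1 T_meas r f_int.
transitivity (\int[mu]_y (f y - (L v y * f y - L s y * f y))).
  by apply: eq_Rintegral => y _; rewrite outer_testE// mulrBl mul1r mulrBl.
rewrite RintegralB//; last exact: integrable_fun_sub.
rewrite RintegralB//; congr (_ - (_ - _));
  first exact: f_mass1; apply: lower_test_mass => //.
  by rewrite v1 (le_trans s0).
by rewrite s0 (le_trans sv).
Qed.

Lemma rule_diff_measurable (phi phi' : Y -> R) :
  decision_rule phi -> decision_rule phi' ->
  measurable_fun [set: Y] (fun y => phi y - phi' y)
  /\ forall y, `|phi y - phi' y| <= 1.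
Proof.
move=> [mp p01] [mq q01]; split; first exact: measurable_funB.
move=> y; have /andP[? ?] := p01 y; have /andP[? ?] := q01 y.
by rewrite ler_norml; apply/andP; lra.
Qed.

Lemma rule_diff_integral (phi phi' rho : Y -> R) :
  decision_rule phi -> decision_rule phi' -> integ rho ->
  \int[mu]_y ((phi y - phi' y) * rho y)
    = \int[mu]_y (phi y * rho y) - \int[mu]_y (phi' y * rho y).
Proof.
move=> rp rq ir; rewrite -RintegralB//; [|exact: rule_mul_integrable..].
by apply: eq_Rintegral => y _; rewrite mulrBl.
Qed.

Variable x : R -> R.
Hypothesis x_incr : {homo x : s t / s < t}.
Hypothesis xf_int : integ (fun y => x (T y) * f y).

(** Keep v - s fixed, so that the integral against f stays that of delta, and
    slide the acceptance region. At s = 0 the test is an upper-tail one, which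
    maximizes the integral against x f at that mass, and at v = 1 it is a
    lower-tail one, which minimizes it. In between the value of delta is
    attained. *)
Lemma outer_test_matching (delta : Y -> R) : decision_rule delta ->
  exists s v, [/\ 0 <= s, s <= v, v <= 1,
    \int[mu]_y (O s v y * f y) = \int[mu]_y (delta y * f y)
  & \int[mu]_y (O s v y * (x (T y) * f y))
      = \int[mu]_y (delta y * (x (T y) * f y))].
Proof.
move=> rd; have [_ d01] := rd.
set A := \int[mu]_y (delta y * f y).
have A0 : 0 <= A.
  by apply: Rintegral_ge0 => y _; rewrite mulr_ge0//; case/andP: (d01 y).
have A1 : A <= 1.
  rewrite -f_mass1; apply: le_Rintegral => //; first exact: rule_mul_integrable.
  by move=> y _; rewrite ler_piMl//; case/andP: (d01 y).
pose h s := \int[mu]_y (O s (s + (1 - A)) y * (x (T y) * f y)).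
have cts : {within `[0, A]%classic, continuous h}.
  apply: continuous_subspaceT => s.
  have := @continuous_outer_test _ _ _ _ _ _ f_int f_ge0 f_mass1 T_meas _ xf_int.
  move=> /(_ _ (s, s + (1 - A))) H.
  have cs : s' + (1 - A) @[s' --> s] --> s + (1 - A).
    by apply: cvgD; [exact: cvg_id|exact: cvg_cst].
  apply: (@continuous2_cvg _ _ _ _ (nbhs s) _ id (fun r => r + (1 - A))
    (fun r v => \int[mu]_y (O r v y * (x (T y) * f y))) s (s + (1 - A)));
    [|exact: cvg_id|exact: cs].
  by apply: H => y ->; rewrite mulr0.
set B := \int[mu]_y (delta y * (x (T y) * f y)).
have mass0 : \int[mu]_y (O 0 (0 + (1 - A)) y * f y) = A.
  by rewrite outer_test_mass ?add0r ?subr0 ?subKr// ?subr_ge0// gerBl.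
have massA : \int[mu]_y (O A (A + (1 - A)) y * f y) = A.
  by rewrite outer_test_mass ?subrKC ?subKr.
have h0 : B <= h 0.
  rewrite -subr_ge0 /h /B -rule_diff_integral//.
  have [mw w1] := rule_diff_measurable (O_rule 0 (0 + (1 - A))) rd.
  apply: (one_sign_change f_int f_ge0 mw w1 _ x_incr xf_int (q := cut (1 - A))).
  - by rewrite rule_diff_integral// mass0 subrr.
  - move=> y cy; rewrite outer_testE ?add0r ?subr_ge0// lower_test0.
    by rewrite lower_test_gt_cutoff// !subr0; case/andP: (d01 y).
  - move=> y cy; rewrite outer_testE ?add0r ?subr_ge0// lower_test0.
    rewrite lower_test_lt_cutoff// subr0 subrr sub0r oppr_le0.
    by case/andP: (d01 y).
have hA : h A <= B.
  rewrite -subr_ge0 /h /B -rule_diff_integral//.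
  have [mw w1] := rule_diff_measurable rd (O_rule A (A + (1 - A))).
  apply: (one_sign_change f_int f_ge0 mw w1 _ x_incr xf_int (q := cut A)).
  - by rewrite rule_diff_integral// massA subrr.
  - move=> y cy; rewrite outer_testE ?subrKC// lower_test1.
    rewrite lower_test_gt_cutoff// subr0 subrr subr0.
    by case/andP: (d01 y).
  - move=> y cy; rewrite outer_testE ?subrKC// lower_test1.
    rewrite lower_test_lt_cutoff// subrr subr0 subr_le0.
    by case/andP: (d01 y).
have hB : Num.min (h 0) (h A) <= B <= Num.max (h 0) (h A).
  apply/andP; split; first by rewrite ge_min; apply/orP; right.
  by rewrite le_max; apply/orP; left.
have [s] := IVT A0 cts hB.
rewrite in_itv/= => /andP[s0 sA] hs.
have sv : s <= s + (1 - A) by rewrite lerDl subr_ge0.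
have v1 : s + (1 - A) <= 1 by rewrite addrCA gerDl subr_le0.
exists s, (s + (1 - A)); split; [exact: s0|exact: sv|exact: v1| |exact: hs].
by rewrite outer_test_mass// (addrC s) addrK subKr.
Qed.

(** The difference with delta is nonnegative where the two-sided test rejects
    and nonpositive where it accepts. *)
Lemma outer_test_domination (delta : Y -> R) (s v : R) (psi : R -> R) :
  decision_rule delta -> s <= v ->
  \int[mu]_y (O s v y * f y) = \int[mu]_y (delta y * f y) ->
  \int[mu]_y (O s v y * (x (T y) * f y))
    = \int[mu]_y (delta y * (x (T y) * f y)) ->
  convex_in x psi -> integ (fun y => psi (T y) * f y) ->
  \int[mu]_y (delta y * (psi (T y) * f y))
    <= \int[mu]_y (O s v y * (psi (T y) * f y)).
Proof.
move=> rd sv eA eB cvx ipsi; have [_ d01] := rd.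
have [mw w1] := rule_diff_measurable (O_rule s v) rd.
rewrite -subr_ge0 -rule_diff_integral//.
apply: (two_sign_changes f_int f_ge0 mw w1 _ x_incr xf_int ipsi cvx _
  (l := cut s) (u := cut v)).
- by rewrite rule_diff_integral// eA subrr.
- by rewrite rule_diff_integral// eB subrr.
- exact: cutoff_nondecreasing.
- move=> y h; have [rej _ _] := outer_test_two_sided sv y.
  by rewrite rej ?subr_ge0; [case/andP: (d01 y)|case: h; [right|left]].
- move=> y h; have [_ _ acc] := outer_test_two_sided sv y.
  by rewrite acc// sub0r oppr_le0; case/andP: (d01 y).
Qed.

End domination.

(** * One-parameter exponential families *)

Section exponential_family.
Context d (Y : measurableType d) (R : realType).
Variables (mu : {sigma_finite_measure set Y -> \bar R}) (h T : Y -> R).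
Hypothesis h_meas : measurable_fun [set: Y] h.
Hypothesis h_ge0 : forall y, 0 <= h y.
Hypothesis T_meas : measurable_fun [set: Y] T.
Local Notation integ phi := (mu.-integrable [set: Y] (EFin \o phi)).
Local Notation N := (normalizer mu h T).
Local Notation p := (expfam_density mu h T).
Local Notation power theta delta := (rejection_prob mu p theta delta).

Let expT_meas theta : measurable_fun [set: Y] (fun y => expR (theta * T y)).
Proof. by apply: measurableT_comp => //; exact: measurable_funM. Qed.

Lemma fine_normalizer_ge0 theta : 0 <= fine (N theta).
Proof.
apply: fine_ge0; apply: integral_ge0 => y _.
by rewrite lee_fin mulr_ge0 ?expR_ge0.
Qed.

Lemma expfam_density_ge0 theta y : 0 <= p theta y.
Proof. by rewrite !mulr_ge0 ?expR_ge0// invr_ge0 fine_normalizer_ge0. Qed.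

Lemma expfam_density_measurable theta : measurable_fun [set: Y] (p theta).
Proof. by apply: measurable_funM => //; exact: measurable_funM. Qed.

(** By Tonelli's theorem, first for the normalizer and then for the power. *)
Lemma rejection_prob_measurable (delta : Y -> R) : decision_rule delta ->
  measurable_fun [set: R] (fun theta => power theta delta).
Proof.
move=> [mdelta delta01].
have mexp : measurable_fun [set: R * Y] (fun z : R * Y => expR (z.1 * T z.2)).
  apply: measurableT_comp => //; apply: measurable_funM => //.
  by apply: measurableT_comp.
have mN : measurable_fun [set: R] N.
  apply: (@measurable_fun_fubini_tonelli_F _ _ _ _ _ mu
    (fun z : R * Y => (h z.2 * expR (z.1 * T z.2))%:E)).
    by apply/measurable_EFinP; apply: measurable_funM => //; exact: measurableT_comp.
  by move=> z; rewrite lee_fin mulr_ge0 ?expR_ge0.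
have mNV : measurable_fun [set: R] (fun theta => (fine (N theta))^-1).
  (* the power function is measurable, and x `^ (- 1) = x^-1 even for x = 0 *)
  have -> : (fun theta => (fine (N theta))^-1)
      = (fun x : R => x `^ (- 1)) \o (fine \o N).
    by apply/funext => theta /=; rewrite powR_inv1// fine_normalizer_ge0.
  apply: measurableT_comp; first exact: measurable_powR.
  by apply: measurableT_comp => //; exact: fine_measurable.
have mp : measurable_fun [set: R * Y]
    (fun z : R * Y => (delta z.2 * p z.1 z.2)%:E).
  apply/measurable_EFinP; apply: measurable_funM; first exact: measurableT_comp.
  apply: measurable_funM => //; apply: measurable_funM; last exact: measurableT_comp.
  exact: (measurableT_comp mNV).
have := @measurable_fun_fubini_tonelli_F _ _ _ _ _ mu _ mp.
move=> mF; apply: (measurableT_comp (@fine_measurable R setT measurableT)).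
apply: mF => z; rewrite lee_fin mulr_ge0 ?expfam_density_ge0//.
by case/andP: (delta01 z.2).
Qed.

Variables a b K : R.
Hypothesis ab : a <= b.
Hypothesis aK : - K < a /\ b < K.
Hypothesis density_mass : forall theta, - K <= theta <= K ->
  (\int[mu]_y (p theta y)%:E = 1)%E.

Section fixed_parameter.
Variable theta : R.
Hypothesis thetaK : - K <= theta <= K.

Lemma fine_normalizer_gt0 : 0 < fine (N theta).
Proof.
rewrite lt_neqAle fine_normalizer_ge0 andbT eq_sym; apply/eqP => N0.
have := density_mass thetaK; rewrite /expfam_density N0 invr0.
under eq_integral do rewrite !mul0r.
by rewrite integral0 => -[] /eqP; rewrite eq_sym oner_eq0.
Qed.

Lemma expfam_density_integrable : integ (p theta).
Proof.
apply/integrableP; split; first exact/measurable_EFinP/expfam_density_measurable.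
under eq_integral do rewrite /= ger0_norm ?expfam_density_ge0//.
by rewrite density_mass// ltry.
Qed.

Lemma expfam_density_mass1 : \int[mu]_y p theta y = 1.
Proof. by rewrite /Rintegral density_mass. Qed.

Lemma rejection_prob_ge0_le1 (delta : Y -> R) : decision_rule delta ->
  0 <= power theta delta <= 1.
Proof.
move=> rd; have [_ d01] := rd; apply/andP; split.
  apply: Rintegral_ge0 => y _; rewrite mulr_ge0 ?expfam_density_ge0//.
  by case/andP: (d01 y).
rewrite -expfam_density_mass1; apply: le_Rintegral => //.
- exact: rule_mul_integrable expfam_density_integrable.
- exact: expfam_density_integrable.
- by move=> y _; rewrite ler_piMl ?expfam_density_ge0//; case/andP: (d01 y).
Qed.

Lemma le_rejection_prob (delta delta' : Y -> R) :
  decision_rule delta -> decision_rule delta' ->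
  (forall y, delta y <= delta' y) -> power theta delta <= power theta delta'.
Proof.
move=> rd rd' dd'; apply: le_Rintegral => //.
- exact: rule_mul_integrable expfam_density_integrable.
- exact: rule_mul_integrable expfam_density_integrable.
- by move=> y _; rewrite ler_wpM2r ?expfam_density_ge0.
Qed.

End fixed_parameter.

Let aK' : - K <= a <= K.
Proof. by move: ab; case: aK => ? ? ?; apply/andP; lra. Qed.
Let bK' : - K <= b <= K.
Proof. by move: ab; case: aK => ? ? ?; apply/andP; lra. Qed.

Local Notation f := (p a).
Local Notation psi theta := (fun t => expR ((theta - a) * t)).

Definition density_ratio theta : R := (fine (N theta))^-1 * fine (N a).

Lemma density_ratioE theta y :
  p theta y = density_ratio theta * (psi theta (T y) * f y).
Proof.
have Na := fine_normalizer_gt0 aK'.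
have -> : psi theta (T y) * f y = (fine (N a))^-1 * h y * expR (theta * T y).
  have -> : theta * T y = (theta - a) * T y + a * T y by ring.
  by rewrite expRD /expfam_density; ring.
by rewrite /density_ratio !mulrA mulfK// gt_eqF.
Qed.

Lemma tilted_integrable theta : - K <= theta <= K ->
  integ (fun y => psi theta (T y) * f y).
Proof.
move=> tK; have r0 : density_ratio theta != 0.
  by rewrite mulf_neq0 ?invr_neq0// gt_eqF// fine_normalizer_gt0.
have -> : (fun y => psi theta (T y) * f y)
    = (fun y => (density_ratio theta)^-1 * p theta y).
  by apply/funext => y; rewrite (density_ratioE theta) mulKf.
exact/integrable_fun_scale/expfam_density_integrable.
Qed.

Lemma rejection_probE theta (delta : Y -> R) : - K <= theta <= K ->
  decision_rule delta -> power theta delta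
    = density_ratio theta * \int[mu]_y (delta y * (psi theta (T y) * f y)).
Proof.
move=> tK rd; rewrite -RintegralZl//; last first.
  exact: rule_mul_integrable (tilted_integrable tK).
by apply: eq_Rintegral => y _; rewrite density_ratioE mulrCA.
Qed.

(** As a is interior to [- K, K], both exp((a - e) T) h and exp((a + e) T) h are
    integrable for a small e > 0, and e |T| <= exp(e T) + exp(- e T). *)
Lemma statistic_integrable : integ (fun y => T y * f y).
Proof.
pose e := Num.min (a + K) (K - a).
have e0 : 0 < e by move: ab; case: aK => ? ? ?; rewrite lt_min; apply/andP; lra.
have eK1 : e <= a + K by rewrite ge_min lexx.
have eK2 : e <= K - a by rewrite ge_min lexx orbT.
have lo : - K <= a - e <= K by move: ab; case: aK => ? ? ?; apply/andP; lra.
have hi : - K <= a + e <= K by move: ab; case: aK => ? ? ?; apply/andP; lra.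
have iB := integrable_fun_scale e^-1
  (integrable_fun_add (tilted_integrable lo) (tilted_integrable hi)).
apply: le_integrable iB => //.
  apply/measurable_EFinP; apply: measurable_funM => //.
  exact: expfam_density_measurable.
move=> y _ /=; rewrite lee_fin.
have f0 := expfam_density_ge0 a y.
rewrite normrM (ger0_norm f0) [leRHS]ger0_norm; last first.
  by rewrite mulr_ge0 ?invr_ge0 ?(ltW e0)// addr_ge0// mulr_ge0// expR_ge0.
rewrite -mulrDl mulrA ler_wpM2r// mulrC ler_pdivlMr//.
have -> : (a - e - a) * T y = - (e * T y) by ring.
have -> : (a + e - a) * T y = e * T y by ring.
have h1 := expR_ge1Dx (e * T y); have h2 := expR_ge1Dx (- (e * T y)).
have h3 := expR_ge0 (e * T y); have h4 := expR_ge0 (- (e * T y)).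
rewrite -{1}(gtr0_norm e0) -normrM mulrC ler_norml; apply/andP; lra.
Qed.

(** The likelihood ratio of b to a if a < b, and its infinitesimal version T if
    a = b. *)
Lemma exists_comparison_scale : exists x : R -> R,
  [/\ {homo x : s t / s < t},
      integ (fun y => x (T y) * f y),
      forall theta, theta < a \/ b < theta -> convex_in x (psi theta)
    & forall theta, a <= theta <= b ->
        convex_in x (fun t => - expR ((theta - a) * t))].
Proof.
move: ab; rewrite le_eqVlt => /predU1P[eab|ltab].
  exists id; split=> //.
  - exact: statistic_integrable.
  - by move=> theta _; exact: expR_convex_in_id.
  - move=> theta; rewrite -eab -eq_le => /eqP <-.
    by move=> t0; exists 0 => t; rewrite subrr !mul0r subrr.
exists (psi b); have ba0 : 0 < b - a by rewrite subr_gt0.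
split.
- by move=> s t st; rewrite ltr_expR ltr_pM2l.
- exact: tilted_integrable.
- by move=> theta ht; apply: expR_convex_in_expR => //; case: ht => ?; [left|right]; lra.
- by move=> theta /andP[? ?]; apply: expR_concave_in_expR => //; apply/andP; lra.
Qed.

Lemma outer_test_dominates (delta : Y -> R) : decision_rule delta ->
  exists s v, [/\ 0 <= s, s <= v, v <= 1,
    forall theta, - K <= theta <= K -> theta < a \/ b < theta ->
      power theta delta <= power theta (outer_test mu f T s v)
  & forall theta, a <= theta <= b ->
      power theta (outer_test mu f T s v) <= power theta delta].
Proof.
move=> rd; have [x [x_incr xf cvx ccv]] := exists_comparison_scale.
have fi := expfam_density_integrable aK'.
have f0 := expfam_density_ge0 a; have f1 := expfam_density_mass1 aK'.
have [s [v [s0 sv v1 eA eB]]] := outer_test_matching fi f0 f1 T_meas x_incr xf rd.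
have rO := outer_test_decision_rule fi f0 f1 T_meas s v.
have r0 theta : - K <= theta <= K -> 0 <= density_ratio theta.
  by move=> tK; rewrite mulr_ge0// ?invr_ge0 ltW// fine_normalizer_gt0.
have dom := outer_test_domination fi f0 f1 T_meas x_incr xf rd sv eA eB.
exists s, v; split=> // theta tK.
  move=> ht; rewrite !rejection_probE// ler_wpM2l ?r0//.
  by apply: (dom (psi theta)); [exact: cvx|exact: tilted_integrable].
have tK' : - K <= theta <= K.
  by case: aK => ? ?; case/andP: tK => ? ?; apply/andP; lra.
rewrite !rejection_probE// ler_wpM2l ?r0// -lerN2.
have it := tilted_integrable tK'.
have e phi : decision_rule phi ->
    - (\int[mu]_y (phi y * (psi theta (T y) * f y)))
    = \int[mu]_y (phi y * (- expR ((theta - a) * T y) * f y)).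
  move=> rphi; rewrite -mulN1r -RintegralZl//; last exact: rule_mul_integrable.
  by apply: eq_Rintegral => y _; ring.
rewrite !e//; apply: (dom (fun t => - expR ((theta - a) * t))); first exact: ccv.
have -> : (fun y => - expR ((theta - a) * T y) * f y)
  = (fun y => - 1 * (psi theta (T y) * f y)) by apply/funext => y; ring.
exact: integrable_fun_scale.
Qed.

End exponential_family.

(** * Continuity along sequences *)

Lemma sequentially_continuous (R : realType) (E : pseudoMetricType R)
    (F : E -> R) (z : E) :
  (forall u : nat -> E, u n @[n --> \oo] --> z -> F (u n) @[n --> \oo] --> F z) ->
  {for z, continuous F}.
Proof.
move=> H; apply/cvgrPdist_lt => e e0; apply: contrapT => nN.
have ex n : exists t, ball z n.+1%:R^-1 t /\ e <= `|F z - F t|.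
  apply: contrapT => /forallNP h; apply: nN.
  apply/nbhs_ballP; exists n.+1%:R^-1 => //= t zt.
  by rewrite ltNge; apply/negP => le; apply: (h t).
have [u hu] := choice ex.
have /cvgrPdist_lt /(_ e e0) [n _ /(_ n (leqnn n)) /=] :
    F (u n) @[n --> \oo] --> F z.
  apply: H; apply/cvg_ballP => r r0; near=> n.
  apply: (@le_ball _ _ z n.+1%:R^-1); last by have [] := hu n.
  by apply: ltW; near: n; exact: (near_infty_natSinv_lt (PosNum r0)).
by rewrite ltNge (hu n).2.
Unshelve. all: by end_near. Qed.

Lemma cvg_continuous_within (R : realType) (D : set R) (g : R -> R)
    (u : nat -> R) (t : R) :
  {within D, continuous g} -> D t -> (forall n, D (u n)) ->
  u n @[n --> \oo] --> t -> g (u n) @[n --> \oo] --> g t.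
Proof.
move=> cg Dt Du ut; apply: (@cvg_comp _ _ _ u g _ (within D (nbhs t))).
  move=> A /ut DA.
  apply: (@filterS _ \oo _ (fun n => D (u n) -> A (u n))) DA => n.
  by apply; exact: Du.
rewrite (nbhs_subspace_in Dt); exact: cg.
Qed.

(** * The optimal two-sided test *)

Section optimal_test.
Context d (Y : measurableType d) (R : realType).
Variables (mu : {sigma_finite_measure set Y -> \bar R}) (h T : Y -> R).
Hypothesis h_meas : measurable_fun [set: Y] h.
Hypothesis h_ge0 : forall y, 0 <= h y.
Hypothesis T_meas : measurable_fun [set: Y] T.
Variables a b K : R.
Hypothesis ab : a <= b.
Hypothesis aK : - K < a /\ b < K.
Local Notation p := (expfam_density mu h T).
Hypothesis density_mass : forall theta, - K <= theta <= K ->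
  (\int[mu]_y (p theta y)%:E = 1)%E.
Variables Lambda0 Lambda1 : probability R R.
Local Notation Theta0 := (`[a, b]%classic : set R).
Local Notation Theta1 := (`[- K, K]%classic `\` `[a, b]%classic : set R).
Hypothesis Lambda0_supp : Lambda0 Theta0 = 1%E.
Variable g : R -> R.
Hypothesis g_meas : measurable_fun (`[0, 1]%classic : set R) g.
Hypothesis g_cont : {within `[0, 1]%classic, continuous g}.
Hypothesis g_nondecr : forall s t, 0 <= s -> s <= t -> t <= 1 -> g s <= g t.

Local Notation integ phi := (mu.-integrable [set: Y] (EFin \o phi)).
Local Notation power theta delta := (rejection_prob mu p theta delta).
Local Notation size delta := (average_size mu p Theta0 Lambda0 delta).
Local Notation gain delta := (objective mu p g Theta1 Lambda1 delta).
Local Notation L := (lower_test mu (p a) T).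
Local Notation O := (outer_test mu (p a) T).

Let Theta0_range theta : Theta0 theta -> - K <= theta <= K.
Proof.
by rewrite /= in_itv/= => /andP[? ?]; move: ab; case: aK => ? ? ?; apply/andP; lra.
Qed.

Let Theta1_range theta : Theta1 theta ->
  - K <= theta <= K /\ (theta < a \/ b < theta).
Proof.
rewrite /= !in_itv/= => -[tK /negP].
by rewrite negb_and -!ltNge => /orP h'; split.
Qed.

Let aK' : - K <= a <= K.
Proof. by move: ab; case: aK => ? ? ?; apply/andP; lra. Qed.

Let fi : integ (p a).
Proof. exact: (expfam_density_integrable h_meas h_ge0 T_meas density_mass). Qed.

Let f0 : forall y, 0 <= p a y.
Proof. exact: expfam_density_ge0. Qed.

Let f1 : \int[mu]_y p a y = 1.
Proof. exact: (expfam_density_mass1 density_mass). Qed.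

Let O_rule s v : decision_rule (O s v).
Proof. exact: outer_test_decision_rule. Qed.

Let mTheta0 : measurable Theta0.
Proof. exact: measurable_itv. Qed.

Let mTheta1 : measurable Theta1.
Proof. by apply: measurableD; exact: measurable_itv. Qed.

Let mpower (D : set R) (delta : Y -> R) : decision_rule delta ->
  measurable_fun D (fun theta => power theta delta).
Proof. by move=> rd; apply: measurable_funTS; exact: rejection_prob_measurable. Qed.

Let power01 theta (delta : Y -> R) : - K <= theta <= K -> decision_rule delta ->
  0 <= power theta delta <= 1.
Proof.
by move=> tK; exact: (rejection_prob_ge0_le1 h_meas h_ge0 T_meas density_mass).
Qed.

Let cst_int (Lambda : probability R R) (D : set R) (k : R) : measurable D ->
  Lambda.-integrable D (EFin \o (fun=> k)).
Proof. exact: finite_measure_integrable_cst. Qed.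

Lemma power_integrable (delta : Y -> R) : decision_rule delta ->
  Lambda0.-integrable Theta0 (EFin \o (fun theta => power theta delta)).
Proof.
move=> rd; apply: (le_integrable mTheta0 _ _ (cst_int Lambda0 1 mTheta0)).
  by apply/measurable_EFinP; exact: mpower.
move=> theta /Theta0_range tK /=; have /andP[p0 p1] := power01 tK rd.
by rewrite lee_fin normr1 ger0_norm.
Qed.

Lemma le_average_size (delta delta' : Y -> R) :
  decision_rule delta -> decision_rule delta' ->
  (forall theta, Theta0 theta -> power theta delta <= power theta delta') ->
  size delta <= size delta'.
Proof. by move=> rd rd' dd'; apply: le_Rintegral => //; exact: power_integrable. Qed.

Let gain_meas (delta : Y -> R) : decision_rule delta ->
  measurable_fun Theta1 (fun theta => g (power theta delta)).
Proof.
move=> rd; apply: (@measurable_comp _ _ _ _ _ _ (`[0, 1]%classic : set R) g Theta1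
  (fun theta => power theta delta)) => //.
- move=> _ [theta /Theta1_range[tK _] <-] /=; rewrite in_itv/=.
  exact: power01.
- exact: mpower.
Qed.

Let gain_bound theta (delta : Y -> R) : Theta1 theta -> decision_rule delta ->
  `|g (power theta delta)| <= `|g 0| + `|g 1|.
Proof.
move=> /Theta1_range[tK _] rd; have /andP[p0 p1] := power01 tK rd.
have h0 := g_nondecr (lexx 0) p0 p1; have h1 := g_nondecr p0 p1 (lexx 1).
have /andP[? ?] : - `|g 0| <= g 0 <= `|g 0| by rewrite -ler_norml.
have /andP[? ?] : - `|g 1| <= g 1 <= `|g 1| by rewrite -ler_norml.
have n0 := normr_ge0 (g 0); have n1 := normr_ge0 (g 1).
by rewrite ler_norml; apply/andP; split; lra.
Qed.

Lemma le_objective (delta delta' : Y -> R) :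
  decision_rule delta -> decision_rule delta' ->
  (forall theta, Theta1 theta -> power theta delta <= power theta delta') ->
  gain delta <= gain delta'.
Proof.
move=> rd rd' dd'.
have ig phi : decision_rule phi ->
    Lambda1.-integrable Theta1 (EFin \o (fun theta => g (power theta phi))).
  move=> rphi.
  apply: (le_integrable mTheta1 _ _ (cst_int Lambda1 (`|g 0| + `|g 1|) mTheta1)).
    by apply/measurable_EFinP; exact: gain_meas.
  move=> theta t1 /=; rewrite lee_fin [leRHS]ger0_norm ?addr_ge0//.
  exact: gain_bound.
apply: le_Rintegral => //; [exact: ig|exact: ig|].
move=> theta t1; have [tK _] := Theta1_range t1.
have /andP[? ?] := power01 tK rd; have /andP[? ?] := power01 tK rd'.
by apply: g_nondecr => //; exact: dd'.
Qed.

Lemma continuous_power theta : - K <= theta <= K ->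
  continuous (fun z : R * R => power theta (O z.1 z.2)).
Proof.
move=> tK; apply: (continuous_outer_test fi f0 f1 T_meas).
  exact: (expfam_density_integrable h_meas h_ge0 T_meas density_mass).
move=> y fy0.
by rewrite (density_ratioE h_ge0 ab aK density_mass theta) fy0 !mulr0.
Qed.

Lemma continuous_average_size :
  continuous (fun z : R * R => size (O z.1 z.2)).
Proof.
move=> z; apply: sequentially_continuous => u uz.
apply: (@cvg_Rintegral_dominated _ _ _ _ _
  (fun n theta => power theta (O (u n).1 (u n).2)) _ (fun=> 1)) => //.
- by move=> n; exact: mpower.
- exact: mpower.
- move=> theta /Theta0_range tK.
  exact: (cvg_comp _ _ uz (continuous_power tK (x := z))).
- exact: cst_int.
- move=> n theta /Theta0_range tK.
  by have /andP[p0 p1] := power01 tK (O_rule (u n).1 (u n).2); rewrite ger0_norm.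
Qed.

Lemma continuous_objective : continuous (fun z : R * R => gain (O z.1 z.2)).
Proof.
move=> z; apply: sequentially_continuous => u uz.
apply: (@cvg_Rintegral_dominated _ _ _ _ _
  (fun n theta => g (power theta (O (u n).1 (u n).2))) _
  (fun=> `|g 0| + `|g 1|)) => //.
- by move=> n; exact: gain_meas.
- exact: gain_meas.
- move=> theta /Theta1_range[tK _].
  apply: (cvg_continuous_within g_cont).
  + by rewrite /= in_itv/=; exact: power01.
  + by move=> n; rewrite /= in_itv/=; exact: power01.
  + exact: (cvg_comp _ _ uz (continuous_power tK (x := z))).
- exact: cst_int.
- by move=> n theta t1; exact: gain_bound.
Qed.

Lemma average_size_cst1 : size (fun=> 1) = 1.
Proof.
transitivity (\int[Lambda0]_(theta in Theta0) (1 : R)).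
  apply: eq_Rintegral => theta /set_mem/Theta0_range tK.
  rewrite -[RHS](expfam_density_mass1 density_mass tK).
  by apply: eq_Rintegral => y _; rewrite mul1r.
by rewrite Rintegral_cst// mul1r; exact: (congr1 fine Lambda0_supp).
Qed.

Lemma average_size_outer_test_ge s v : v <= s -> size (O s v) = 1.
Proof.
move=> vs; rewrite -average_size_cst1; congr average_size.
by apply/funext => y; exact: (outer_test_ge fi f0 f1 T_meas).
Qed.

Variable alpha : R.
Hypothesis alpha_range : 0 < alpha < 1.

(** The dominating two-sided test may be too small. Increasing s to v enlarges
    it continuously up to the rule that always rejects, so that the size passes
    through alpha, and g is nondecreasing. *)
Lemma exists_better_outer_test (delta : Y -> R) : decision_rule delta ->
  size delta <= alpha ->
  exists s v, [/\ 0 <= s, s <= v, v <= 1, size (O s v) = alpha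
    & gain delta <= gain (O s v)].
Proof.
move=> rd sd.
have [s [v [s0 sv v1 up down]]] :=
  outer_test_dominates h_meas h_ge0 T_meas ab aK density_mass rd.
have size_s : size (O s v) <= alpha.
  by apply: le_trans sd; apply: le_average_size.
have cts : {within `[s, v]%classic, continuous (fun r => size (O r v))}.
  apply: continuous_subspaceT => r.
  apply: (@continuous2_cvg _ _ _ _ (nbhs r) _ id (fun=> v)
    (fun r v => size (O r v)) r v); [|exact: cvg_id|exact: cvg_cst].
  exact: (continuous_average_size (x := (r, v))).
have hB : Num.min (size (O s v)) (size (O v v)) <= alpha
    <= Num.max (size (O s v)) (size (O v v)).
  have /andP[size_v _] : 1 <= size (O v v) <= 1.
    by rewrite -eq_le; apply/eqP/esym; exact: average_size_outer_test_ge.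
  have size_v' : alpha <= size (O v v).
    by apply: le_trans size_v; case/andP: alpha_range => _ /ltW.
  apply/andP; split; first by rewrite ge_min; apply/orP; left.
  by rewrite le_max; apply/orP; right.
have [r] := IVT sv cts hB.
rewrite in_itv/= => /andP[sr rv] size_r.
exists r, v; split; [exact: le_trans sr|exact: rv|exact: v1|exact: size_r|].
have Ole y : O s v y <= O r v y.
  rewrite (outer_testE fi f0 f1 T_meas y sv) (outer_testE fi f0 f1 T_meas y rv).
  rewrite lerD2l lerN2 lerD2l lerN2.
  exact: (lower_test_nondecreasing fi f0 f1 T_meas).
apply: le_objective => // theta t1; have [tK out] := Theta1_range t1.
apply: le_trans (up theta tK out) _.
exact: (le_rejection_prob h_meas h_ge0 T_meas density_mass).
Qed.

(** If both cutoffs are equal then the two lower-tail tests differ only on the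
    level set of T at that cutoff, which thus carries mass v - s > 0. *)
Lemma cutoffs_atom s v : 0 <= s -> s < v -> v <= 1 ->
  cutoff mu (p a) T s = cutoff mu (p a) T v ->
  (0 < \int[mu]_(y in [set y | (T y)%:E = cutoff mu (p a) T s]) (h y)%:E)%E.
Proof.
move=> s0 sv v1 cc; set A := [set y | _].
have mA : measurable A.
  have := (measurableT_comp (@EFin_measurable R setT) T_meas) measurableT.
  move=> /(_ [set cutoff mu (p a) T s] (emeasurable_set1 _)).
  by rewrite setTI.
rewrite lt_neqAle integral_ge0 ?andbT; last by move=> y _; rewrite lee_fin.
apply/eqP => /esym hA0.
have iA : (\int[mu]_y ((h \_ A) y)%:E = 0)%E.
  by rewrite -hA0 [RHS]integral_mkcond; apply: eq_integral => y _; rewrite restrict_EFin.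
have hA_ge0 y : 0 <= (h \_ A) y by rewrite patchE; case: ifP.
have ihA : integ (h \_ A).
  apply/integrableP; split.
    apply/measurable_EFinP/(measurable_restrict _ mA measurableT).
    by apply: measurable_funTS.
  under eq_integral do rewrite /= ger0_norm//.
  by rewrite iA ltry.
have iL r : integ (fun y => L r y * p a y).
  exact: (lower_test_integrable fi f0 f1 T_meas).
have mass : \int[mu]_y (L v y * p a y - L s y * p a y) = v - s.
  rewrite RintegralB//; congr (_ - _); apply: (lower_test_mass fi f0 f1 T_meas).
    by rewrite v1 (le_trans s0 (ltW sv)).
  by rewrite s0 (le_trans (ltW sv)).
suff : v - s = 0 by apply/eqP; rewrite subr_eq0 gt_eqF.
rewrite -mass; apply: (Rintegral_eq0_eq0 ihA hA_ge0).
- by rewrite /Rintegral iA.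
- exact: integrable_measurable (integrable_fun_sub (iL v) (iL s)).
- move=> y; rewrite patchE; case: ifPn => [yA hy|yA _].
    have -> : p a y = 0 by rewrite /expfam_density hy mulr0 mul0r.
    by rewrite !mulr0 subrr.
  have : (T y)%:E != cutoff mu (p a) T s.
    by apply/eqP => e; move/negP: yA; apply; rewrite inE.
  rewrite neq_lt => /orP[Tc|cT].
    by rewrite !lower_test_lt_cutoff -?cc// subrr.
  by rewrite !lower_test_gt_cutoff -?cc// !mul0r subrr.
Qed.

(** The pairs (s, v) of size alpha form a compact set, on which the objective is
    continuous; a maximizer beats every feasible rule because each of these is
    dominated by a test of the family. *)
Lemma exists_optimal_outer_test : exists delta : Y -> R,
  [/\ optimal_rule mu p g Theta0 Theta1 Lambda0 Lambda1 alpha delta,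
      size delta = alpha
    & exists (l u : \bar R) (gamma : Y -> R),
        [/\ (l <= u)%E,
            l = u -> (0 < \int[mu]_(y in [set y | (T y)%:E = l]) (h y)%:E)%E,
            decision_rule gamma
          & two_sided T l u gamma delta]].
Proof.
pose C : set (R * R) := (`[0, 1]%classic `*` `[0, 1]%classic)
  `&` (fun z => size (O z.1 z.2)) @^-1` [set alpha].
have inC s v : 0 <= s -> s <= v -> v <= 1 -> size (O s v) = alpha -> C (s, v).
  move=> s0 sv v1 sz; split=> //; split; rewrite /= in_itv/=.
    by rewrite s0 (le_trans sv).
  by rewrite v1 (le_trans s0).
have C_nonempty : C !=set0.
  have r0 : decision_rule (fun _ : Y => 0 : R).
    by split=> // y; rewrite lexx ler01.
  have sz0 : size (fun=> 0) <= alpha.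
    rewrite /average_size; under eq_Rintegral => theta _.
      rewrite /rejection_prob; under eq_Rintegral do rewrite mul0r.
      rewrite Rintegral_cst// mul0r.
      over.
    by rewrite Rintegral_cst// mul0r; case/andP: alpha_range => /ltW.
  have [s [v [s0 sv v1 sz _]]] := exists_better_outer_test r0 sz0.
  by exists (s, v); exact: inC.
have C_compact : compact C.
  apply: compact_closedI; first by apply: compact_setX; exact: segment_compact.
  by apply: (proj1 (continuous_closedP _) continuous_average_size); exact: closed_eq.
have [[s v] /set_mem[[/=]]] := compact_EVT_max C_nonempty C_compact
  (continuous_subspaceT continuous_objective).
rewrite !in_itv/= => /andP[s0 s1] /andP[v0 v1] sz best.
have sv : s < v.
  rewrite ltNge; apply/negP => /average_size_outer_test_ge; rewrite sz => e.
  by move: alpha_range; rewrite e ltxx andbF.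
exists (O s v); split; [|exact: sz|].
  split; first by split; [exact: O_rule|rewrite sz].
  move=> delta [rd sd].
  have [s' [v' [s'0 sv' v'1 sz' le]]] := exists_better_outer_test rd sd.
  by apply: le_trans le _; apply: (best (s', v')); apply: mem_set; exact: inC.
exists (cutoff mu (p a) T s), (cutoff mu (p a) T v), (O s v); split.
- by apply: (cutoff_nondecreasing fi f0 f1 T_meas); exact: ltW.
- by move=> cc; exact: (cutoffs_atom s0 sv v1 cc).
- exact: O_rule.
- by apply: (outer_test_two_sided fi f0 f1 T_meas); exact: ltW.
Qed.

End optimal_test.

Theorem theorem9 (R : realType) (n : nat) (n_gt0 : (0 < n)%N)
    (Y : set (n.-tuple R)) (y0 : Y)
    (mu : {sigma_finite_measure set (sample_space y0) -> \bar R})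
    (h T : sample_space y0 -> R)
    (h_meas : measurable_fun [set: sample_space y0] h)
    (h_ge0 : forall y, 0 <= h y)
    (T_meas : measurable_fun [set: sample_space y0] T)
    (D_open : open (natural_space mu h T))
    (a b K : R) (a_le_b : a <= b) (K_gt : Num.max `|a| `|b| < K)
    (Theta Theta0 Theta1 : set R)
    (Theta_def : Theta = `[- K, K]%classic)
    (Theta0_def : Theta0 = `[a, b]%classic)
    (Theta1_def : Theta1 = Theta `\` Theta0)
    (Theta_sub : Theta `<=` natural_space mu h T)
    (f_density : forall theta, Theta theta ->
      (\int[mu]_y (expfam_density mu h T theta y)%:E = 1)%E)
    (alpha : R) (alpha_range : 0 < alpha < 1)
    (Lambda0 Lambda1 : probability R R)
    (Lambda0_supp : Lambda0 Theta0 = 1%E)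
    (Lambda1_supp : Lambda1 Theta1 = 1%E)
    (g : R -> R)
    (g_meas : measurable_fun (`[0, 1]%classic : set R) g)
    (g_derivable : forall t : R, 0 < t < 1 -> derivable g t 1)
    (g'_cont : forall t : R, 0 < t < 1 -> {for t, continuous (derive1 g)})
    (g_cont0 : g x @[x --> 0^'+] --> g 0)
    (g_cont1 : g x @[x --> 1^'-] --> g 1)
    (g'_gt0 : forall t : R, 0 < t < 1 -> 0 < derive1 g t) :
  exists delta : sample_space y0 -> R,
    [/\ optimal_rule mu (expfam_density mu h T) g Theta0 Theta1
          Lambda0 Lambda1 alpha delta,
        average_size mu (expfam_density mu h T) Theta0 Lambda0 delta = alpha
      & exists (l u : \bar R) (gamma : sample_space y0 -> R),
          [/\ (l <= u)%E,
              l = u -> (0 < \int[mu]_(y in [set y | (T y)%:E = l]) (h y)%:E)%E,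
              decision_rule gamma
            & two_sided T l u gamma delta]].

Proof.
have aK : - K < a /\ b < K.
  move: K_gt; rewrite gt_max !ltr_norml => /andP[/andP[? _] /andP[_ ?]].
  by split.
have g_cont : {within `[0, 1]%classic, continuous g}.
  apply/continuous_within_itvP; first exact: ltr01.
  split=> // t; rewrite in_itv/= => t01.
  exact/differentiable_continuous/derivable1_diffP/g_derivable.
have g_nondecr s t : 0 <= s -> s <= t -> t <= 1 -> g s <= g t.
  move=> s0; rewrite le_eqVlt => /predU1P[->//|st] t1; apply: ltW.
  by apply: (gtr0_derive1_incr _ _ g_cont s0 st t1) => r; rewrite in_itv/=;
    [exact: g_derivable|exact: g'_gt0].
subst Theta Theta0 Theta1.
exact: exists_optimal_outer_test.
Qed.
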